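(* Let $c^*:=1/40$. Let $(s_t)_{t\ge0}$ be an orbit with $m(s_t)\le m^*$ for all $t$, let $\delta=\delta(s_0)$ (which is invariant along the orbit), and put $$C_1:=4(m^*\delta)^{3/2}/c^{*3},\qquad C_H:=\max(8m^*\delta,\,4C_1^2).$$ Then $H(s_{t+1})\le\max(H(s_t),C_H)$ for all $t$. Consequently $H(s_t)\le\max(H(s_0),C_H)$ for all $t$, so that Hypothesis (B), $\liminf_{t\to\infty}H(s_t)<\infty$, holds. Consequently, if $L$ satisfies Hypothesis $(\mathrm C_\kappa)$ for some $\kappa\in\mathbb N$, then for every admissible initial state $s_0$ Hypothesis (B) holds and the orbit is eventually periodic: there exist $t_0$, $P\ge1$ and a unit $\lambda\in\mathcal O_K^\times$ with $\sigma_r(\lambda)>0$ such that $s_{t+P}=\lambda s_t$ for all $t\ge t_0$, and the digit sequence is eventually $P$-periodic.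
   Context: $K$ is a cubic number field of signature $(1,1)$, with real embedding $\sigma_r$, complex embedding $\sigma_c$ and field norm $N$; $L\subset\mathcal O_K$ is an order. A state is an ordered triple $s=(u_1,u_2,u_3)$ of elements of $L$ forming a $\mathbb Q$-basis of $K$; it is admissible if $x_i=\sigma_r(u_i)>0$ for all $i$, and sorted so that $x_1\ge x_2\ge x_3>0$. For a unit $\lambda$, $\lambda s=(\lambda u_1,\lambda u_2,\lambda u_3)$. The height is $H(s)=\max_i|N(u_i)|$. Put $\xi=(x_1,x_2,x_3)$, $\hat\xi=\xi/|\xi|$, $(\sigma_c(u_1),\sigma_c(u_2),\sigma_c(u_3))=a+ib$ with $a,b\in\mathbb R^3$, $\delta(s)=2|\det(\xi,a,b)|=|\mathrm{disc}(u_1,u_2,u_3)|^{1/2}$, $a_\perp=a-\langle a,\hat\xi\rangle\hat\xi$, $b_\perp=b-\langle b,\hat\xi\rangle\hat\xi$; the conformal module is $m(s)=(|a_\perp|^2+|b_\perp|^2)/(2|a_\perp\times b_\perp|)$. Algorithm: for $A,B,g\in\mathbb Z_{\ge0}$ not all zero, the move $V(A,B,g)$ sends $(u_1,u_2,u_3)$ to $(u_1-g(u_2-Bu_3)-Au_3,\ u_2-Bu_3,\ u_3)$, and $W$ sends it to $(u_1-u_2,\ u_2,\ u_3-(u_1-u_2))$. At a state $s$ the candidates are the images under those moves for which all new real coordinates are positive. The algorithm selects the candidate of minimal $m$, ties being broken by a fixed total order depending only on the move labels, and re-sorts it to get the next state. The orbit of $s_0$ is the resulting sequence $(s_t)$;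 its digit sequence is the sequence of selected moves. Hypothesis $(\mathrm C_\kappa)$ for $L$: there exist $\gamma>1$ and $m_0\ge1$ such that from every admissible state $s$ of $L$ with $m(s)\ge m_0$, the orbit of the algorithm started at $s$ reaches a state of module $\le\max(m(s)/\gamma,\,m_0)$ within at most $\kappa$ steps. *)

(* Defs.v *)
From HB Require Import structures.
From mathcomp Require Import all_boot all_order all_algebra all_field.
From mathcomp Require Import all_classical all_reals all_analysis.
From mathcomp Require Import complex.

Set Implicit Arguments.
Unset Strict Implicit.
Unset Printing Implicit Defensive.

Import Order.TTheory GRing.Theory Num.Theory.

Local Open Scope ring_scope.

(* V A B g stands for the move V(A, B, g); V 0 0 0 is a term of this type but
   is excluded by move_ok. *)
Inductive move := V of nat & nat & nat | W.

Definition move_code (d : move) : option (nat * nat * nat) :=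
  if d is V A B g then Some (A, B, g) else None.
Definition move_decode (o : option (nat * nat * nat)) : move :=
  if o is Some (A, B, g) then V A B g else W.
Lemma move_codeK : cancel move_code move_decode.
Proof. by case. Qed.
HB.instance Definition _ := Choice.copy move (can_type move_codeK).

Definition move_ok (d : move) : bool := d != V 0 0 0.

Section NumberField.
Variable K : fieldExtType rat.

(* N(u) = determinant of the Q-linear endomorphism x |-> u * x of K *)
Definition field_norm (u : K) : rat :=
  \det (passmx.mxof (vbasis {:K}) (vbasis {:K}) (amull u)).

Definition is_alg_int (x : K) : Prop := integralOver (intr : int -> K) x.

Definition is_int_unit (x : K) : Prop :=
  [/\ x != 0, is_alg_int x & is_alg_int x^-1].

(* A subring of the ring of integers which is the Z-span of a Q-basis of K *)
Definition is_order (L : {pred K}) : Prop :=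
  [/\ subring_closed L,
      forall x, x \in L -> is_alg_int x
    & exists e : (\dim {:K}).-tuple K,
        basis_of {:K} e /\ (forall x, x \in L <-> inIntSpan e x)].

Definition state := 3.-tuple K.

Definition mk3 (u1 u2 u3 : K) : state := [tuple u1; u2; u3].

Definition scale_state (lambda : K) (s : state) : state :=
  [tuple of map ( *%R lambda) s].

Definition is_state (L : {pred K}) (s : state) : Prop :=
  basis_of {:K} s /\ {subset s <= L}.

Definition apply_move (d : move) (s : state) : state :=
  let u1 := s`_0 in let u2 := s`_1 in let u3 := s`_2 in
  match d with
  | V A B g => mk3 (u1 - (u2 - u3 *+ B) *+ g - u3 *+ A) (u2 - u3 *+ B) u3
  | W => mk3 (u1 - u2) u2 (u3 - (u1 - u2))
  end.

End NumberField.

Section Algorithm.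
Variables (R : realType) (K : fieldExtType rat).
Variables (sigma_r : {rmorphism K -> R}) (sigma_c : {rmorphism K -> R[i]}).

(* One real embedding and one pair of complex conjugate (non-real)
   embeddings. *)
Definition signature11 : Prop :=
  (exists x, complex.Im (sigma_c x) != 0) /\
  (forall tau : {rmorphism K -> R[i]},
     [\/ forall x, tau x = (sigma_r x)%:C%C,
         forall x, tau x = sigma_c x
       | forall x, tau x = (sigma_c x)^*%C]).

Definition positive_state (s : state K) : bool :=
  all (fun u => 0 < sigma_r u) s.

Definition admissible (L : {pred K}) (s : state K) : Prop :=
  [/\ is_state L s, positive_state s
    & sorted (fun u v => sigma_r v <= sigma_r u) s].

Definition resort (s : state K) : state K :=
  [tuple of sort (fun u v => sigma_r v <= sigma_r u) s].

Definition height (s : state K) : R :=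
  \big[Num.max/0]_(u <- s) `|ratr (field_norm u)|.

(* The library norm on 'rV[R]_n is the sup norm, hence a separate Euclidean
   norm. *)
Definition dot (v w : 'rV[R]_3) : R := \sum_i v 0 i * w 0 i.
Definition enorm (v : 'rV[R]_3) : R := Num.sqrt (dot v v).

Definition cross (v w : 'rV[R]_3) : 'rV[R]_3 :=
  \row_(i < 3) (v 0 (i + 1) * w 0 (i + 2%:R) - v 0 (i + 2%:R) * w 0 (i + 1)).

Definition xi (s : state K) : 'rV[R]_3 := \row_i sigma_r (tnth s i).
Definition re_part (s : state K) : 'rV[R]_3 :=
  \row_i complex.Re (sigma_c (tnth s i)).
Definition im_part (s : state K) : 'rV[R]_3 :=
  \row_i complex.Im (sigma_c (tnth s i)).

Definition xi_hat (s : state K) : 'rV[R]_3 := (enorm (xi s))^-1 *: xi s.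

Definition perp (s : state K) (v : 'rV[R]_3) : 'rV[R]_3 :=
  v - dot v (xi_hat s) *: xi_hat s.

Definition delta (s : state K) : R :=
  2 * `|\det (\matrix_(i < 3) [:: xi s; re_part s; im_part s]`_i)|.

Definition conf_module (s : state K) : R :=
  let a' := perp s (re_part s) in
  let b' := perp s (im_part s) in
  (enorm a' ^+ 2 + enorm b' ^+ 2) / (2 * enorm (cross a' b')).

Definition candidate (s : state K) (d : move) : bool :=
  move_ok d && positive_state (apply_move d s).

Variable tie : rel move.

Definition selected (s : state K) (d : move) : Prop :=
  candidate s d /\
  forall d', candidate s d' ->
    let m := conf_module (apply_move d s) in
    let m' := conf_module (apply_move d' s) in
    m < m' \/ (m = m' /\ tie d d').

(* At an admissible state V(1,0,0) is a candidate and there are finitely many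
   candidates, so for a total order tie exactly one move is selected; the
   default W is never used. *)
Definition select (s : state K) : move := xget W [set d | selected s d]%classic.

Definition next_state (s : state K) : state K := resort (apply_move (select s) s).

Definition algo_orbit (s0 : state K) (t : nat) : state K := iter t next_state s0.

Definition digit (s0 : state K) (t : nat) : move := select (algo_orbit s0 t).

Definition hyp_C (L : {pred K}) (kappa : nat) : Prop :=
  exists gamma m0 : R, [/\ 1 < gamma, 1 <= m0 &
    forall s, admissible L s -> m0 <= conf_module s ->
      exists2 k : nat, (k <= kappa)%N &
        conf_module (algo_orbit s k) <= Num.max (conf_module s / gamma) m0].

Definition hyp_B (s0 : state K) : Prop :=
  (limn_einf (fun t => (height (algo_orbit s0 t))%:E) < +oo)%E.

Definition eventually_periodic (s0 : state K) : Prop :=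
  exists (t0 P : nat) (lambda : K),
    [/\ (1 <= P)%N, is_int_unit lambda, 0 < sigma_r lambda,
        forall t, (t0 <= t)%N ->
          algo_orbit s0 (t + P) = scale_state lambda (algo_orbit s0 t)
      & exists t1 : nat, forall t, (t1 <= t)%N ->
          digit s0 (t + P) = digit s0 t].

End Algorithm.

Section Constants.
Variable R : realType.

Definition cstar : R := 1 / 40.
Definition C1 (mstar delta : R) : R :=
  4 * (mstar * delta) `^ (3 / 2) / cstar ^+ 3.
Definition CH (mstar delta : R) : R :=
  Num.max (8 * mstar * delta) (4 * C1 mstar delta ^+ 2).

End Constants.

(* Main.v *)
Require Import Defs.
From mathcomp Require Import all_boot all_order all_algebra all_field.
From mathcomp Require Import all_classical all_reals all_analysis.
From mathcomp Require Import perm complex.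
From mathcomp Require Import ring lra zify.

(** Why the theorem holds.  Write x_u = sr u and z_u = sc u for the two embeddings,
    so that N(u) = x_u |z_u|^2 ([ratr_field_norm]).

    The conformal module of a state is Q |xi| / delta, where Q is the minimum over
    the complex slopes c of the sum of the |z_i - c x_i|^2 ([conf_moduleE],
    [deviation_min]).  If it is at most m, then there are c and q such that
    |z_i - c x_i| <= q for all i and q^2 x_j <= D for all j, with D = m delta
    ([deviation_bound]).

    Height.  Apply this to the state after a step.  An entry v with
    N(v) > C_H has |c| so large compared with q^3 that, since the norms of
    nonzero elements of L are at least 1 in absolute value, |c| x_w >= 3 q for
    all new entries w ([slope_large], [slope_dominates]).  The move only
    subtracted, so the old entry u in the place of v is v plus new entries with
    coefficients in nat.  Each of these contributes at least 3 q to |c| x and at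
    most q to the deviation; therefore |z_u| >= |z_v| ([sum_growth]), and
    x_u >= x_v, hence N(v) <= N(u) <= H(s) ([height_step]).  Invariance of delta and
    finiteness of the lower limit follow easily.

    Periodicity.  The candidate V(1,0,0) at most quadruples the module
    ([module_growth]), and the selected move does no worse; as the module
    returns to a bounded range at least every kappa steps, it stays bounded
    ([bounded_of_returns]), and so does the height.  Up to units of L there are
    then only finitely many states: with N the norm of the first entry u_0, the
    elements N u_i / u_0 of L lie in a bounded region of the Minkowski space
    ([ratio_bounded]), hence in a finite set, and u_0 lies in one of finitely
    many classes modulo N L; these data determine the state up to a unit
    ([unit_multiple_of_data]).  By the pigeonhole principle two states of the
    orbit differ by a unit of positive real embedding, and the algorithm
    commutes with multiplication by such a unit ([scale_orbit]). *)

Set Implicit Arguments.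
Unset Strict Implicit.
Unset Printing Implicit Defensive.

Import Order.TTheory GRing.Theory Num.Theory.
Import ComplexField.Normc.

Local Open Scope ring_scope.

(** * Real coordinates on a cubic field *)

Lemma det_mx33 (F : comPzRingType) (M : 'M[F]_3) :
  \det M = M 0 0 * (M 1 1 * M 2%:R 2%:R - M 1 2%:R * M 2%:R 1)
         - M 0 1 * (M 1 0 * M 2%:R 2%:R - M 1 2%:R * M 2%:R 0)
         + M 0 2%:R * (M 1 0 * M 2%:R 1 - M 1 1 * M 2%:R 0).
Proof.
(* Indexing the entries by nat lets the lifted ordinals of the expansion
   compute. *)
pose f (i j : nat) := M (inord i) (inord j).
have -> : M = \matrix_(i, j) f i j.
  by apply/matrixP=> i j; rewrite mxE /f !inord_val.
move: f => f {M}.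
rewrite (expand_det_row _ 0) !big_ord_recl big_ord0 /cofactor.
rewrite !(expand_det_row _ ord0) !big_ord_recl !big_ord0 /cofactor !det_mx11.
rewrite !mxE /= /bump /=.
ring.
Qed.

Section RealCoordinates.
Variables (R : realType) (K : fieldExtType rat).
Variables (sr : {rmorphism K -> R}) (sc : {rmorphism K -> R[i]}).

(** The Minkowski embedding of K into the real 3-space: a real form of the
    three embeddings, so that no conjugate embedding has to be carried
    around. *)
Definition coords (u : K) : 'rV[R]_3 :=
  \row_j [:: sr u; complex.Re (sc u); complex.Im (sc u)]`_j.

Definition coords_mx n (e : n.-tuple K) : 'M[R]_(n, 3) :=
  \matrix_i coords e`_i.

Lemma real_embZ (q : rat) (u : K) : sr (q *: u) = ratr q * sr u.
Proof.
rewrite -[u in LHS]mul1r scalerAl rmorphM; congr (_ * _).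
exact: (fmorph_eq_rat (sr \o in_alg K)).
Qed.

Lemma complex_embZ (q : rat) (u : K) : sc (q *: u) = (ratr q)%:C%C * sc u.
Proof.
rewrite -[u in LHS]mul1r scalerAl rmorphM; congr (_ * _).
have -> : sc q%:A = ratr q := fmorph_eq_rat (sc \o in_alg K) q.
by have <- : (ratr q)%:C%C = ratr q :> R[i] := fmorph_eq_rat (real_complex R \o ratr) q.
Qed.

Lemma Re_add (x y : R[i]) : complex.Re (x + y) = complex.Re x + complex.Re y.
Proof. by case: x y => [a b] [c d]. Qed.
Lemma Im_add (x y : R[i]) : complex.Im (x + y) = complex.Im x + complex.Im y.
Proof. by case: x y => [a b] [c d]. Qed.
Lemma Re_mul (x y : R[i]) :
  complex.Re (x * y) = complex.Re x * complex.Re y - complex.Im x * complex.Im y.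
Proof. by case: x y => [a b] [c d]. Qed.
Lemma Im_mul (x y : R[i]) :
  complex.Im (x * y) = complex.Re x * complex.Im y + complex.Im x * complex.Re y.
Proof. by case: x y => [a b] [c d]. Qed.

Lemma coords_linear (q : rat) (u v : K) :
  coords (q *: u + v) = ratr q *: coords u + coords v.
Proof.
apply/rowP=> j; rewrite !mxE !rmorphD /= real_embZ complex_embZ Re_add Im_add Re_mul Im_mul /=.
by case: j => [[|[|[]]]] //= _; ring.
Qed.

Lemma coords0 : coords 0 = 0.
Proof.
by apply/rowP=> -[[|[|[]]]] //= ?; rewrite !mxE ?rmorph0.
Qed.

Lemma coords_sum n (f : 'I_n -> rat) (g : 'I_n -> K) :
  coords (\sum_i f i *: g i) = \sum_i ratr (f i) *: coords (g i).
Proof.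
elim: n f g => [|n IH] f g; first by rewrite !big_ord0 coords0.
by rewrite !big_ord_recl coords_linear IH.
Qed.

(** Multiplication by (sr u, sc u) on the product of R and C, acting on row
    vectors on the right. *)
Definition mul_coords_mx (u : K) : 'M[R]_3 :=
  \matrix_(i, j) (nth [::]
     [:: [:: sr u; 0; 0];
         [:: 0; complex.Re (sc u); complex.Im (sc u)];
         [:: 0; - complex.Im (sc u); complex.Re (sc u)]] i)`_j.

Lemma coordsM (u v : K) : coords (u * v) = coords v *m mul_coords_mx u.
Proof.
apply/rowP=> j; rewrite !mxE !rmorphM /= Re_mul Im_mul !big_ord_recl big_ord0 !mxE /=.
by case: j => [[|[|[]]]] //= _; ring.
Qed.

Lemma det_mul_coords_mx (u : K) :
  \det (mul_coords_mx u) = sr u * normc (sc u) ^+ 2.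
Proof.
rewrite det_mx33 !mxE /=; case: (sc u) => a b /=.
by rewrite sqr_sqrtr ?addr_ge0 ?sqr_ge0 //; ring.
Qed.

Definition mulmat n (e : n.-tuple K) (u : K) : 'M[rat]_n :=
  \matrix_(i, j) coord e j (u * e`_i).

Lemma mulmatE n (e : n.-tuple K) u (i : 'I_n) : basis_of {:K} e ->
  u * e`_i = \sum_j mulmat e u i j *: e`_j.
Proof.
move=> he; rewrite {1}(coord_basis he (memvf (u * e`_i))).
by apply: eq_bigr => j _; rewrite mxE.
Qed.

Lemma coords_mx_mul n (e : n.-tuple K) u : basis_of {:K} e ->
  map_mx ratr (mulmat e u) *m coords_mx e = coords_mx e *m mul_coords_mx u.
Proof.
move=> he; apply/row_matrixP => i; rewrite !row_mul rowK -coordsM mulmatE // coords_sum.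
apply/rowP=> j; rewrite summxE mxE; apply: eq_bigr => k _.
by rewrite !mxE.
Qed.

Hypothesis sc_nonreal : exists x, complex.Im (sc x) != 0.

(** Dedekind's argument: if l = v0 sr + v1 Re sc + v2 Im sc vanishes on K, then
    so does y |-> l (x y) - sr x l y = Re (w sc y) with
    w = (v1 - i v2) (sc x - sr x).  Taking y = 1 and y = x gives w = 0, and
    sc x <> sr x when sc x is not real. *)
Lemma coords_functional_eq0 (v : 'rV[R]_3) :
  (forall u, \sum_j v 0 j * coords u 0 j = 0) -> v = 0.
Proof.
have [x hx] := sc_nonreal.
pose l u := v 0 0 * sr u + v 0 1 * complex.Re (sc u) + v 0 2%:R * complex.Im (sc u).
move=> h0.
have h u : l u = 0.
  rewrite -[RHS](h0 u) !big_ord_recl big_ord0 !mxE /= /l addr0 -addrA.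
  by congr (_ * _ + (v _ _ * _ + v _ _ * _)); apply: val_inj.
have h1 := h 1; rewrite /l !rmorph1 /= in h1.
have hh u : l (x * u) - sr x * l u = 0 by rewrite !h mulr0 subr0.
have h2 := hh 1; have h3 := hh x.
rewrite /l !rmorphM !Re_mul !Im_mul !rmorph1 /= in h2 h3.
have : [/\ v 0 0 = 0, v 0 1 = 0 & v 0 2%:R = 0].
  move: hx h1 h2 h3; move: (sr x) (complex.Re (sc x)) (complex.Im (sc x)) => r a b.
  move: (v 0 0) (v 0 1) (v 0 2%:R) => v0 v1 v2 b0 h1 h2 h3.
  have p0 : v1 * (a - r) + v2 * b = 0 by rewrite -[RHS]h2; ring.
  have q0 : v1 * b - v2 * (a - r) = 0.
    by apply: (mulIf b0); have := congr1 ( *%R a) p0; lra.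
  have n0 : (a - r) ^+ 2 + b ^+ 2 != 0.
    by rewrite lt0r_neq0 // ltr_wpDl ?sqr_ge0 // exprn_even_gt0.
  have z1 : v1 = 0.
    apply: (mulIf n0).
    by have := congr1 ( *%R (a - r)) p0; have := congr1 ( *%R b) q0; lra.
  have z2 : v2 = 0.
    apply: (mulIf n0).
    by have := congr1 ( *%R b) p0; have := congr1 ( *%R (a - r)) q0; lra.
  by split=> //; move: h1; rewrite z1 z2 => <-; ring.
case=> e0 e1 e2; apply/rowP => -[[|[|[]]]] // hi; rewrite mxE.
- by rewrite -[RHS]e0; congr (v _ _); apply: val_inj.
- by rewrite -[RHS]e1; congr (v _ _); apply: val_inj.
- by rewrite -[RHS]e2; congr (v _ _); apply: val_inj.
Qed.

(** A vanishing determinant would be a real linear relation between the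
    coordinates that holds on a basis, hence on K. *)
Lemma coords_mx_det_neq0 (e : 3.-tuple K) :
  basis_of {:K} e -> \det (coords_mx e) != 0.
Proof.
move=> he; rewrite -det_tr; apply/det0P => -[v v0 hv].
case/eqP: v0; apply: coords_functional_eq0 => u.
have hi (i : 'I_3) : \sum_j v 0 j * coords e`_i 0 j = 0.
  have /rowP/(_ i) := hv; rewrite !mxE => h; rewrite -[RHS]h.
  by apply: eq_bigr => j _; rewrite !mxE.
rewrite (coord_basis he (memvf u)) coords_sum.
under eq_bigr => j _ do rewrite summxE mulr_sumr.
rewrite exchange_big /= big1 // => i _.
under eq_bigr => j _ do rewrite mxE mulrCA.
by rewrite -mulr_sumr hi mulr0.
Qed.

(** Multiplication by u over Q and its action on real coordinates are conjugate
    through the invertible matrix [coords_mx e], so they have the same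
    determinant; in particular the left hand side does not depend on e. *)
Lemma ratr_det_mulmat (e : 3.-tuple K) u : basis_of {:K} e ->
  ratr (\det (mulmat e u)) = sr u * normc (sc u) ^+ 2.
Proof.
move=> he; have d0 := coords_mx_det_neq0 he.
apply: (mulfI d0); rewrite -det_mul_coords_mx -det_mulmx -coords_mx_mul //.
by rewrite det_mulmx det_map_mx mulrC.
Qed.

Hypothesis hdim : \dim {:K} = 3%N.

Lemma ratr_field_norm u : ratr (field_norm u) = sr u * normc (sc u) ^+ 2.
Proof.
have -> : field_norm u = \det (mulmat (vbasis {:K}) u).
  congr (\det _); apply/matrixP=> i j.
  by rewrite !mxE /= passmx.vecof_delta lfunE.
have := vbasisP {:K}; move: (vbasis {:K}); rewrite hdim => e he.
exact: ratr_det_mulmat.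
Qed.

Lemma field_normE (e : 3.-tuple K) u :
  basis_of {:K} e -> field_norm u = \det (mulmat e u).
Proof.
move=> he; apply: (fmorph_inj (@ratr R)).
by rewrite /= ratr_field_norm (ratr_det_mulmat u he).
Qed.

End RealCoordinates.

(** * Integral coordinates in an order *)

Section IntegerSpan.
Variables (K : fieldExtType rat) (n : nat) (e : n.-tuple K).

Definition int_comb (a : 'rV[int]_n) : K := \sum_(i < n) e`_i *~ a 0 i.

Lemma inIntSpanE x : inIntSpan e x <-> exists a, x = int_comb a.
Proof.
split=> [[a ->]|[a ->]].
  by exists (\row_i a i); apply: eq_bigr => i _; rewrite mxE.
by exists [ffun i : 'I_n => a 0 i]; apply: eq_bigr => i _; rewrite ffunE.
Qed.

Lemma int_combZ (k : int) a : int_comb (k *: a) = int_comb a *~ k.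
Proof.
rewrite /int_comb mulrz_suml; apply: eq_bigr => i _.
by rewrite mxE -mulrzA mulrC.
Qed.

Lemma int_combD a b : int_comb (a + b) = int_comb a + int_comb b.
Proof.
rewrite /int_comb -big_split /=; apply: eq_bigr => i _.
by rewrite mxE mulrzDr.
Qed.

Lemma int_comb_mulmx (a : 'rV_n) (M : 'M[int]_n) (u : K) :
  (forall i : 'I_n, u * e`_i = int_comb (row i M)) ->
  u * int_comb a = int_comb (a *m M).
Proof.
move=> hM; rewrite /int_comb mulr_sumr.
under eq_bigr => i _ do rewrite mulrzAr hM /int_comb mulrz_suml.
rewrite exchange_big /=; apply: eq_bigr => j _.
rewrite mxE mulrz_sumr; apply: eq_bigr => i _.
by rewrite mxE -mulrzA mulrC.
Qed.

End IntegerSpan.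

Section Order.
Variables (R : realType) (K : fieldExtType rat).
Variables (sr : {rmorphism K -> R}) (sc : {rmorphism K -> R[i]}).
Hypothesis sc_nonreal : exists x, complex.Im (sc x) != 0.
Hypothesis hdim : \dim {:K} = 3%N.

Lemma coords_int_comb (e : 3.-tuple K) (a : 'rV[int]_3) :
  coords sr sc (int_comb e a) = map_mx intr a *m coords_mx sr sc e.
Proof.
rewrite /int_comb.
under eq_bigr => i _ do rewrite -scaler_int.
rewrite coords_sum; apply/rowP => j; rewrite summxE mxE.
by apply: eq_bigr => i _; rewrite !mxE ratr_int.
Qed.

(** The integral coordinates are the image of the real ones under the inverse
    of [coords_mx e]: an order is discrete in the Minkowski space. *)
Lemma int_comb_bounded (e : 3.-tuple K) : basis_of {:K} e ->
  exists C : R, forall (a : 'rV[int]_3) (B : R),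
    (forall j, `|coords sr sc (int_comb e a) 0 j| <= B) ->
    forall i, `|a 0 i|%:~R <= C * B.
Proof.
move=> he; pose P := coords_mx sr sc e.
have uP : P \in unitmx by rewrite unitmxE unitfE coords_mx_det_neq0.
exists (\sum_j \sum_i `|invmx P j i|) => a B hB i.
have B0 : 0 <= B by apply: le_trans (hB 0).
have -> : (`|a 0 i|%:~R : R) = `|(coords sr sc (int_comb e a) *m invmx P) 0 i|.
  by rewrite coords_int_comb mulmxK // mxE intr_norm.
rewrite mxE; apply: le_trans (ler_norm_sum _ _ _) _.
rewrite mulr_suml; apply: ler_sum => j _.
rewrite normrM mulrC; apply: ler_pM => //.
by rewrite (bigD1 i) //= lerDl sumr_ge0.
Qed.

Variable L : {pred K}.
Hypothesis hL : is_order L.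

Lemma order_basis : exists e : 3.-tuple K,
  basis_of {:K} e /\ (forall x, x \in L <-> exists a, x = int_comb e a).
Proof.
have [_ _ +] := hL; rewrite hdim => -[e [he hx]]; exists e; split=> // x.
by rewrite hx; apply: inIntSpanE.
Qed.

(** Multiplication by u has an integral matrix M in a Z-basis of L.  The norm is
    n = det M, and the adjugate of M represents x |-> n x / u, which therefore
    preserves L. *)
Lemma order_norm u : u \in L -> exists n : int,
  field_norm u = n%:~R /\
  (u != 0 -> forall x, x \in L -> n%:~R * x / u \in L).
Proof.
move=> uL; have [e [he hLe]] := order_basis; have [[_ _ LM] _ _] := hL.
have eL (i : 'I_3) : e`_i \in L.
  apply/hLe; exists (delta_mx 0 i); rewrite /int_comb (bigD1 i) //= mxE !eqxx mulr1z.
  by rewrite big1 ?addr0 // => j ji; rewrite mxE (negPf ji) andbF mulr0z.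
have hr (i : 'I_3) : exists a, u * e`_i = int_comb e a by apply: (proj1 (hLe _)); apply: LM (eL i).
have [r hr'] := choice hr.
pose M : 'M[int]_3 := \matrix_i r i.
have hM (i : 'I_3) : u * e`_i = int_comb e (row i M) by rewrite rowK.
have MM : mulmat e u = map_mx intr M.
  apply/matrixP => i j; rewrite !mxE hr' /int_comb.
  under eq_bigr => k _ do rewrite -scaler_int.
  by rewrite coord_sum_free // (basis_free he).
exists (\det M); split.
  by rewrite (field_normE sr sc_nonreal hdim _ he) MM det_map_mx.
move=> u0 x xL; have [a ->] := proj1 (hLe x) xL; apply: (proj2 (hLe _)).
exists (a *m \adj M).
apply: (mulfI u0); rewrite (int_comb_mulmx _ hM) -mulmxA mul_adj_mx mul_mx_scalar.
by rewrite int_combZ -[RHS]mulrzl mulrCA mulfV ?mulr1.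
Qed.

End Order.

(** * The conformal module as a least-squares deviation *)

Section ConformalModule.
Variables (R : realType) (K : fieldExtType rat).
Variables (sr : {rmorphism K -> R}) (sc : {rmorphism K -> R[i]}).
Implicit Types (s t : state K) (c : R[i]).

Definition real_norm2 s : R := \sum_(u <- s) sr u ^+ 2.

Definition deviation s c : R :=
  \sum_(u <- s) normc (sc u - c * (sr u)%:C%C) ^+ 2.

(** The coefficient of the orthogonal projection of (sc u_i) on (sr u_i). *)
Definition best_slope s : R[i] :=
  Complex ((\sum_(u <- s) complex.Re (sc u) * sr u) / real_norm2 s)
  ((\sum_(u <- s) complex.Im (sc u) * sr u) / real_norm2 s).

Lemma sum_state (F : K -> R) s : \sum_(u <- s) F u = F s`_0 + F s`_1 + F s`_2.
Proof.
by case: s => [[|u1 [|u2 [|u3 []]]] //= _]; rewrite !big_cons big_nil addr0 addrA.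
Qed.

Lemma normc_ge0 (z : R[i]) : 0 <= normc z.
Proof. by case: z => a b; apply: sqrtr_ge0. Qed.

Lemma sqr_normc (z : R[i]) : normc z ^+ 2 = complex.Re z ^+ 2 + complex.Im z ^+ 2.
Proof. by case: z => a b; rewrite sqr_sqrtr ?addr_ge0 ?sqr_ge0. Qed.

Lemma delta_coords s : delta sr sc s = 2 * `|\det (coords_mx sr sc s)|.
Proof.
rewrite /delta -[in RHS]det_tr; congr (2 * `|\det _|); apply/matrixP=> i j; rewrite !mxE.
by case: i => [[|[|[]]]] //= _; rewrite mxE (tnth_nth 0).
Qed.

Lemma deviationE s c : deviation s c =
  \sum_(u <- s) ((complex.Re (sc u) - complex.Re c * sr u) ^+ 2 +
                 (complex.Im (sc u) - complex.Im c * sr u) ^+ 2).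
Proof.
apply: eq_bigr => u _; rewrite sqr_normc; case: (sc u) c => [a b] [p q] /=.
by congr (_ ^+ 2 + _ ^+ 2); ring.
Qed.

Lemma deviation_min s c : 0 < real_norm2 s ->
  deviation s (best_slope s) <= deviation s c.
Proof.
rewrite !deviationE /best_slope /real_norm2 !sum_state /=.
case: c => p q /=.
move: (sr s`_0) (sr s`_1) (sr s`_2) => x y z.
move: (complex.Re (sc s`_0)) (complex.Re (sc s`_1)) (complex.Re (sc s`_2)) => a1 a2 a3.
move: (complex.Im (sc s`_0)) (complex.Im (sc s`_1)) (complex.Im (sc s`_2)) => b1 b2 b3.
set X2 := x ^+ 2 + y ^+ 2 + z ^+ 2 => X0.
set A := a1 * x + a2 * y + a3 * z; set B := b1 * x + b2 * y + b3 * z.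
rewrite -subr_ge0.
set D := (X in 0 <= X).
have -> : D = X2 * (p - A / X2) ^+ 2 + X2 * (q - B / X2) ^+ 2.
  have X0' := lt0r_neq0 X0; rewrite /D /A /B; move: X0' {D X0}; rewrite /X2 => X0.
  by field.
by rewrite addr_ge0 // mulr_ge0 ?sqr_ge0 ?ltW.
Qed.

(** The numerator of the module is the squared distance from (sc u_i) to the
    complex line spanned by (sr u_i); the cross product of the two projected
    vectors is (det / |xi|^2) xi, so the denominator is delta / |xi|.  Unlike
    the definition, this form is visibly symmetric in the entries and gives
    upper bounds by [deviation_min]. *)
Lemma conf_moduleE s : 0 < real_norm2 s ->
  conf_module sr sc s =
  deviation s (best_slope s) * Num.sqrt (real_norm2 s) / delta sr sc s.
Proof.
move=> X0; rewrite delta_coords /conf_module.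
have dotE (v w : 'rV[R]_3) : dot v w = v 0 0 * w 0 0 + v 0 1 * w 0 1 + v 0 2%:R * w 0 2%:R.
  rewrite /dot !big_ord_recl big_ord0 addr0 addrA.
  by congr (_ * _ + v _ _ * w _ _ + v _ _ * w _ _); apply: val_inj.
have dot_ge0 (v : 'rV[R]_3) : 0 <= dot v v.
  by apply: sumr_ge0 => i _; rewrite -expr2 sqr_ge0.
have xx : dot (xi sr s) (xi sr s) = real_norm2 s.
  by rewrite dotE !mxE /real_norm2 sum_state !(tnth_nth 0) /= -!expr2.
have perpE v : perp sr s v = v - (dot v (xi sr s) / real_norm2 s) *: xi sr s.
  rewrite /perp /xi_hat /enorm xx; congr (_ - _).
  rewrite scalerA; congr (_ *: _).
  have -> : dot v ((Num.sqrt (real_norm2 s))^-1 *: xi sr s) =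
            dot v (xi sr s) / Num.sqrt (real_norm2 s).
    rewrite /dot mulr_suml; apply: eq_bigr => i _; rewrite mxE; ring.
  by rewrite -mulrA -invfM -expr2 sqr_sqrtr // ltW.
set a' := perp sr s _; set b' := perp sr s _.
have -> : cross a' b' = (\det (coords_mx sr sc s) / real_norm2 s) *: xi sr s.
  rewrite /a' /b' !perpE !dotE det_mx33.
  apply/rowP=> i; rewrite !mxE !(tnth_nth 0).
  have X1 : sr s`_0 ^+ 2 + sr s`_1 ^+ 2 + sr s`_2 ^+ 2 != 0.
    by rewrite -(sum_state (fun u => sr u ^+ 2)) lt0r_neq0.
  rewrite /real_norm2 sum_state.
  by case: i => [[|[|[]]]] //= _; field.
have r0 : 0 < Num.sqrt (real_norm2 s) by rewrite sqrtr_gt0.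
have r2 : Num.sqrt (real_norm2 s) ^+ 2 = real_norm2 s by rewrite sqr_sqrtr // ltW.
have enormZ k : enorm (k *: xi sr s) = `|k| * Num.sqrt (real_norm2 s).
  rewrite /enorm -xx -sqrtr_sqr -sqrtrM ?sqr_ge0 //; congr Num.sqrt.
  by rewrite /dot mulr_sumr; apply: eq_bigr => i _; rewrite mxE; ring.
have enorm2 (v : 'rV[R]_3) : enorm v ^+ 2 = dot v v by rewrite sqr_sqrtr ?dot_ge0.
have -> : enorm a' ^+ 2 + enorm b' ^+ 2 = deviation s (best_slope s).
  rewrite !enorm2 /a' /b' !perpE deviationE sum_state /= !dotE !mxE !(tnth_nth 0) /=.
  by rewrite /real_norm2 !sum_state; ring.
rewrite enormZ normrM normfV (gtr0_norm X0).
move: (Num.sqrt _) r0 r2 (deviation _ _) `|_| => r r0 <- Q d.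
have -> : 2 * (d / r ^+ 2 * r) = 2 * d / r by field; rewrite lt0r_neq0.
by rewrite invfM invrK; ring.
Qed.

Lemma perm_real_norm2 s t : perm_eq s t -> real_norm2 s = real_norm2 t.
Proof. exact: perm_big. Qed.

Lemma perm_deviation s t c : perm_eq s t -> deviation s c = deviation t c.
Proof. exact: perm_big. Qed.

Lemma perm_best_slope s t : perm_eq s t -> best_slope s = best_slope t.
Proof.
by move=> st; rewrite /best_slope (perm_real_norm2 st) !(perm_big _ st).
Qed.

Lemma perm_delta s t : perm_eq s t -> delta sr sc s = delta sr sc t.
Proof.
move=> /tuple_permP[p sp]; rewrite !delta_coords.
have -> : coords_mx sr sc s = row_perm p (coords_mx sr sc t).
  apply/matrixP=> i j; rewrite !mxE sp (nth_map i) ?size_enum_ord //.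
  by rewrite (tnth_nth 0) nth_ord_enum.
by rewrite row_permE det_mulmx det_perm normrM normrX normrN1 expr1n mul1r.
Qed.

Lemma perm_conf_module s t : 0 < real_norm2 s -> perm_eq s t ->
  conf_module sr sc s = conf_module sr sc t.
Proof.
move=> X0 st; have X0' := X0; rewrite (perm_real_norm2 st) in X0'.
rewrite !conf_moduleE // (perm_best_slope st) (perm_deviation _ st).
by rewrite (perm_real_norm2 st) (perm_delta st).
Qed.

Lemma scale_real_norm2 l s : real_norm2 (scale_state l s) = sr l ^+ 2 * real_norm2 s.
Proof.
by rewrite /real_norm2 big_map mulr_sumr; apply: eq_bigr => u _; rewrite rmorphM exprMn.
Qed.

Lemma scale_delta l s :
  delta sr sc (scale_state l s) = `|sr l| * normc (sc l) ^+ 2 * delta sr sc s.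
Proof.
rewrite !delta_coords.
have -> : coords_mx sr sc (scale_state l s) = coords_mx sr sc s *m mul_coords_mx sr sc l.
  apply/row_matrixP => i; rewrite row_mul !rowK -coordsM.
  by rewrite (nth_map 0) ?size_tuple.
rewrite det_mulmx det_mul_coords_mx 2!normrM (ger0_norm (sqr_ge0 (normc (sc l)))).
ring.
Qed.

(** Slopes for s correspond to slopes for l s through c |-> sc l c / sr l, which
    multiplies deviations by |sc l|^2; the factors cancel against those of
    |xi| and delta. *)
Lemma scale_conf_module l s : 0 < sr l -> 0 < real_norm2 s ->
  conf_module sr sc (scale_state l s) = conf_module sr sc s.
Proof.
move=> l0 X0; have lX : 0 < real_norm2 (scale_state l s).
  by rewrite scale_real_norm2 mulr_gt0 // exprn_gt0.
rewrite !conf_moduleE //.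
have l1 : l != 0 by apply: contraTneq l0 => ->; rewrite rmorph0 ltxx.
have n0 : normc (sc l) != 0.
  by apply: contraNneq l1 => /eq0_normc /eqP; rewrite fmorph_eq0.
have sl : (sr l)%:C%C != 0 :> R[i].
  by rewrite eq_complex /= eqxx andbT lt0r_neq0.
have dl c : deviation (scale_state l s) (sc l * c / (sr l)%:C%C) =
            normc (sc l) ^+ 2 * deviation s c.
  rewrite /deviation big_map mulr_sumr; apply: eq_bigr => u _.
  rewrite -exprMn -normcM !rmorphM /=; congr (normc _ ^+ 2).
  by rewrite mulrBr [X in _ - X]mulrA divfK // mulrA.
have -> : deviation (scale_state l s) (best_slope (scale_state l s)) =
          normc (sc l) ^+ 2 * deviation s (best_slope s).
  apply/eqP; rewrite eq_le -{1}dl deviation_min //=.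
  pose c := best_slope (scale_state l s).
  have -> : best_slope (scale_state l s) = sc l * (c * (sr l)%:C%C / sc l) / (sr l)%:C%C.
    by rewrite mulrCA divff ?fmorph_eq0 // mulr1 mulfK.
  have n_gt0 : 0 < normc (sc l) by rewrite lt0r n0 normc_ge0.
  by rewrite dl ler_pM2l ?exprn_gt0 ?deviation_min.
rewrite scale_delta scale_real_norm2 sqrtrM ?sqr_ge0 // sqrtr_sqr gtr0_norm //.
rewrite invfM; have := lt0r_neq0 l0; move: n0.
move: (normc _) (Num.sqrt _) (delta _ _ _)^-1 (deviation _ _) (sr l) => n q d Q r n0 r0.
by field; rewrite n0.
Qed.

Lemma real_norm2_ge s u : u \in s -> sr u ^+ 2 <= real_norm2 s.
Proof.
move=> us; rewrite /real_norm2 (big_rem u) //= lerDl.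
by apply: sumr_ge0 => v _; apply: sqr_ge0.
Qed.

(** This is how a bound on the module is used: all z_i = sc u_i lie within q of
    c x_i, where q^2 is at most M delta / x_j for every j. *)
Lemma deviation_bound s (M : R) u v : 0 < real_norm2 s -> delta sr sc s != 0 ->
  conf_module sr sc s <= M -> u \in s -> v \in s ->
  normc (sc u - best_slope s * (sr u)%:C%C) ^+ 2 * sr v <= M * delta sr sc s.
Proof.
move=> X0 d0 hM us vs.
have dp : 0 < delta sr sc s by rewrite lt0r d0 /= delta_coords mulr_ge0.
rewrite -ler_pdivrMr //; apply: le_trans hM; rewrite conf_moduleE //.
rewrite ler_pM2r ?invr_gt0 //.
have n2 : normc (sc u - best_slope s * (sr u)%:C%C) ^+ 2 <= deviation s (best_slope s).
  rewrite /deviation (big_rem u) //= lerDl.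
  by apply: sumr_ge0 => w _; apply: sqr_ge0.
apply: le_trans (ler_wpM2l (sqr_ge0 _) _) (ler_wpM2r (sqrtr_ge0 _) n2).
apply: le_trans (ler_norm _) _; rewrite -sqrtr_sqr ler_sqrt ?real_norm2_ge //.
exact: ltW.
Qed.

End ConformalModule.

(** * Moves *)

Section Moves.
Variables (K : fieldExtType rat).
Implicit Types (s t : state K).

(** Moves only subtract: each old entry is the new entry at the same place plus
    a combination of new entries with coefficients in nat.  The preservation
    of bases, the decrease of real coordinates and the control of norms all
    come from this form. *)
Lemma move_nonneg_inverse d s (i : 'I_3) : exists k : 'I_3 -> nat,
  s`_i = (apply_move d s)`_i + \sum_(j < 3) (apply_move d s)`_j *+ k j.
Proof.
case: i => [i hi] /=.
pose f3 (a b c : nat) (j : 'I_3) := nth 0%N [:: a; b; c] j.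
suff [a [b [c E]]] : exists a b c : nat, s`_i = (apply_move d s)`_i +
   ((apply_move d s)`_0 *+ a + (apply_move d s)`_1 *+ b + (apply_move d s)`_2 *+ c).
  by exists (f3 a b c); rewrite [LHS]E !big_ord_recl big_ord0 addr0 /f3 /= -!addrA.
case: d => [A B g|]; case: i hi => [|[|[|]]] // _ /=.
- by exists 0%N, g, A; rewrite mulr0n add0r; ring.
- by exists 0%N, 0%N, B; rewrite !mulr0n !add0r; ring.
- by exists 0%N, 0%N, 0%N; rewrite !mulr0n; ring.
- by exists 0%N, 1%N, 0%N; rewrite !mulr0n mulr1n; ring.
- by exists 0%N, 0%N, 0%N; rewrite !mulr0n; ring.
- by exists 1%N, 0%N, 0%N; rewrite !mulr0n mulr1n; ring.
Qed.

Lemma apply_move_subset (L : {pred K}) d s : subring_closed L ->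
  {subset s <= L} -> {subset apply_move d s <= L}.
Proof.
move=> [L1 LB _] sL.
have m i : (i < 3)%N -> s`_i \in L by move=> hi; apply: sL; rewrite mem_nth ?size_tuple.
have L0 : 0 \in L by rewrite -(subrr 1) LB.
have LD x y : x \in L -> y \in L -> x + y \in L.
  by move=> hx hy; rewrite -[y]opprK LB // -[- y]sub0r LB.
have Ln x n : x \in L -> x *+ n \in L.
  by move=> hx; elim: n => [|n IH]; rewrite ?mulr0n // mulrS LD.
have := m 0%N isT; have := m 1%N isT; have := m 2%N isT => m2 m1 m0.
by case: d => [A B g|] u /=; rewrite !inE => /or3P[] /eqP ->; rewrite ?(LB, Ln).
Qed.

Lemma apply_move_basis d s : \dim {:K} = 3%N ->
  basis_of {:K} s -> basis_of {:K} (apply_move d s).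
Proof.
move=> hdim hs; set t := apply_move d s.
rewrite basisEdim hdim size_tuple leqnn andbT -(span_basis hs).
apply/span_subvP => u /(nthP 0)[i hi <-]; rewrite size_tuple in hi.
have ht j : (j < 3)%N -> t`_j \in <<t>>%VS by move=> hj; rewrite memv_span ?mem_nth ?size_tuple.
have [k ->] := move_nonneg_inverse d s (Ordinal hi).
by rewrite memvD ?ht // memv_suml // => j _; rewrite rpredMn ?ht.
Qed.

Lemma apply_move_state (L : {pred K}) d s : \dim {:K} = 3%N -> subring_closed L ->
  is_state L s -> is_state L (apply_move d s).
Proof. by move=> hdim hL [hb hs]; split; [apply: apply_move_basis | apply: apply_move_subset]. Qed.

Lemma scale_apply_move l d s : apply_move d (scale_state l s) = scale_state l (apply_move d s).
Proof.
have e i : (i < 3)%N -> (scale_state l s)`_i = l * s`_i.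
  by move=> hi; rewrite (nth_map 0) ?size_tuple.
apply: val_inj; case: d => [A B g|]; rewrite /apply_move /= !e //.
  by congr [:: _; _; _]; ring.
by congr [:: _; _; _]; ring.
Qed.

End Moves.

Section RealMoves.
Variables (R : realType) (K : fieldExtType rat).
Variables (sr : {rmorphism K -> R}) (sc : {rmorphism K -> R[i]}).
Implicit Types (s t : state K).

Lemma coordsB u v : coords sr sc (u - v) = coords sr sc u - coords sr sc v.
Proof.
have -> : u - v = (-1) *: v + u by rewrite scaleN1r addrC.
by rewrite coords_linear rmorphN1 scaleN1r addrC.
Qed.

Lemma coordsMn u n : coords sr sc (u *+ n) = coords sr sc u *+ n.
Proof.
elim: n => [|n IH]; first by rewrite !mulr0n coords0.
have -> : u *+ n.+1 = 1 *: u + u *+ n by rewrite scale1r mulrS.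
by rewrite coords_linear rmorph1 scale1r IH mulrS.
Qed.

Lemma apply_move_delta d s : delta sr sc (apply_move d s) = delta sr sc s.
Proof.
rewrite !delta_coords; congr (2 * `|_|).
have E t : coords_mx sr sc t =
    \matrix_(i < 3) [:: coords sr sc t`_0; coords sr sc t`_1; coords sr sc t`_2]`_i.
  apply/row_matrixP => i; rewrite !rowK.
  by case: i => [[|[|[]]]].
rewrite !E !det_mx33.
case: d => [A B g|] /=; rewrite !(coordsB, coordsMn).
  move: (coords _ _ _) (coords _ _ _) (coords _ _ _) => p q r.
  by rewrite !mxE /= ?(mxE, mulmxnE); ring.
move: (coords _ _ _) (coords _ _ _) (coords _ _ _) => p q r.
by rewrite !mxE /= ?(mxE, mulmxnE); ring.
Qed.

Lemma real_norm2_gt0 s : positive_state sr s -> 0 < real_norm2 sr s.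
Proof.
move=> /allP hs; rewrite /real_norm2 sum_state.
have p i : (i < 3)%N -> 0 < sr s`_i ^+ 2.
  by move=> hi; rewrite exprn_gt0 // hs // mem_nth ?size_tuple.
by rewrite !addr_gt0 ?p.
Qed.

Lemma apply_move_le d s (i : 'I_3) : positive_state sr (apply_move d s) ->
  sr (apply_move d s)`_i <= sr s`_i.
Proof.
move=> /allP ht; have [k ->] := move_nonneg_inverse d s i.
rewrite rmorphD lerDl raddf_sum sumr_ge0 // => j _.
by rewrite raddfMn mulrn_wge0 // ltW // ht // mem_nth ?size_tuple.
Qed.

End RealMoves.

(** * Large slopes force norms to decrease *)

Section HeightStep.
Variable R : realType.

Lemma C1_sq (m d : R) : 0 <= m * d -> C1 m d ^+ 2 = 16 * 40 ^+ 6 * (m * d) ^+ 3.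
Proof.
move=> D0; rewrite /C1 /cstar.
have -> : (4 * (m * d) `^ (3 / 2) / (1 / 40) ^+ 3) ^+ 2 =
          16 * 40 ^+ 6 * ((m * d) `^ (3 / 2)) ^+ 2 by field.
rewrite -[(_ `^ _) ^+ 2]powR_mulrn ?powR_ge0 // -powRrM.
by rewrite (_ : 3 / 2 * 2%:R = 3%:R) ?powR_mulrn //; field.
Qed.

(** A norm N = x z^2 above C_H can only come from the slope term n x, since
    q^2 x <= D = m d makes the deviation contribute at most 2 D.  What remains
    is n^2 x^3 > C_1^2 = 16 * 40^6 D^3 >= 16 * 40^6 (q^2 x)^3, and x^3 cancels.
    The constant 48 is the one needed by [slope_dominates]. *)
Lemma slope_large (m d q n x z : R) : 0 <= q -> 0 <= n -> 0 < x -> 0 <= z ->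
  q ^+ 2 * x <= m * d -> z <= q + n * x -> CH m d < x * z ^+ 2 ->
  48 * q ^+ 3 < n.
Proof.
move=> q0 n0 x0 z0 hq hz hC.
have D0 : 0 <= m * d by apply: le_trans hq; rewrite mulr_ge0 ?sqr_ge0 // ltW.
have h1 : 8 * (m * d) <= CH m d by rewrite mulrA /CH le_max lexx.
have h2 : 4 * C1 m d ^+ 2 <= CH m d by rewrite /CH le_max lexx orbT.
rewrite (C1_sq D0) in h2.
have h3 : x * z ^+ 2 <= 2 * (q ^+ 2 * x) + 2 * (n ^+ 2 * x ^+ 3).
  have : z ^+ 2 <= (q + n * x) ^+ 2 by rewrite ler_sqr ?nnegrE ?addr_ge0 ?mulr_ge0 // ltW.
  have := sqr_ge0 (q - n * x) => hs hz2.
  have := ler_wpM2l (ltW x0) hz2; have := ler_wpM2l (ltW x0) hs; lra.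
have h4 : 16 * 40 ^+ 6 * (m * d) ^+ 3 < n ^+ 2 * x ^+ 3 by lra.
have h5 : (q ^+ 2 * x) ^+ 3 <= (m * d) ^+ 3.
  by rewrite lerXn2r ?nnegrE // mulr_ge0 ?sqr_ge0 // ltW.
have h6 : 48 ^+ 2 * (q ^+ 2 * x) ^+ 3 < n ^+ 2 * x ^+ 3.
  have : 0 <= (q ^+ 2 * x) ^+ 3.
    by rewrite exprn_ge0 // mulr_ge0 ?sqr_ge0 // ltW.
  lra.
have h7 : (48 * q ^+ 3) ^+ 2 < n ^+ 2.
  rewrite -(ltr_pM2r (exprn_gt0 3 x0)); apply: le_lt_trans h6; rewrite le_eqVlt; apply/orP; left.
  by apply/eqP; ring.
by move: h7; rewrite ltr_pXn2r ?nnegrE // mulr_ge0 // exprn_ge0.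
Qed.

(** Integrality prevents x from being small: if n x < 3 q then z < 4 q, so
    1 <= x z^2 gives 16 q^2 x >= 1, whence n <= 16 q^2 (n x) < 48 q^3. *)
Lemma slope_dominates (q n x z : R) : 0 <= q -> 0 <= n -> 0 < x -> 0 <= z ->
  z <= q + n * x -> 1 <= x * z ^+ 2 -> 48 * q ^+ 3 < n -> 3 * q <= n * x.
Proof.
move=> q0 n0 x0 z0 hz h1 hn; rewrite leNgt; apply/negP => hlt.
have h2 : z ^+ 2 <= (4 * q) ^+ 2 by rewrite ler_sqr ?nnegrE; lra.
have h3 : 1 <= x * (16 * q ^+ 2).
  by apply: le_trans h1 _; rewrite ler_wpM2l ?(ltW x0) //; lra.
have h4 : n <= n * x * (16 * q ^+ 2) by rewrite -mulrA ler_peMr.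
have h5 : n * x * (16 * q ^+ 2) <= 3 * q * (16 * q ^+ 2).
  by rewrite ler_wpM2r ?(ltW hlt) // mulr_ge0 ?sqr_ge0.
have : 0 <= q ^+ 3 by rewrite exprn_ge0.
lra.
Qed.

Variables (K : fieldExtType rat).
Variables (sr : {rmorphism K -> R}) (sc : {rmorphism K -> R[i]}).

Lemma normc_real (x : R) : 0 <= x -> normc x%:C%C = x.
Proof. by move=> x0 /=; rewrite expr0n /= addr0 sqrtr_sqr ger0_norm. Qed.

Lemma normc_sum_mulrn (I : Type) (r : seq I) (f : I -> R[i]) (k : I -> nat) (q : R) :
  (forall i, normc (f i) <= q) ->
  normc (\sum_(i <- r) f i *+ k i) <= (\sum_(i <- r) k i)%:R * q.
Proof.
move=> hf; elim: r => [|i r IH]; first by rewrite !big_nil normc0 mul0r.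
rewrite !big_cons natrD mulrDl; apply: le_trans (le_normcD _ _) (lerD _ IH).
by rewrite normcMn -[leLHS]mulr_natl ler_wpM2l.
Qed.

(** Let u be the sum and n >= 1 the number of added entries.  The deviation of u is
    at most (1 + n) q while |c| sr u >= |c| sr v + 3 n q, so that
    |sc u| >= |c| sr v + (2 n - 1) q >= |c| sr v + q >= |sc v|. *)
Lemma sum_growth (t : state K) (v : K) (k : 'I_3 -> nat) (c : R[i]) (q : R) :
  0 <= q ->
  (forall w, w \in t -> normc (sc w - c * (sr w)%:C%C) <= q) ->
  (forall w, w \in t -> 0 < sr w) ->
  (forall w, w \in t -> 3 * q <= normc c * sr w) ->
  v \in t ->
  normc (sc v) <= normc (sc (v + \sum_(j < 3) t`_j *+ k j)).
Proof.
move=> q0 hq hp h3 vt.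
have tj (j : 'I_3) : t`_j \in t by rewrite mem_nth ?size_tuple.
set u := v + _.
have [k0|k1] := posnP (\sum_(j < 3) k j)%N.
  rewrite /u big1 ?addr0 // => j _; suff -> : k j = 0%N by [].
  by apply/eqP; rewrite -leqn0 -k0 (bigD1 j) //= leq_addr.
have k1R : (1 : R) <= (\sum_(j < 3) k j)%:R by rewrite ler1n.
pose dev w := sc w - c * (sr w)%:C%C.
have dev0 : dev 0 = 0 by rewrite /dev !rmorph0 mulr0 subr0.
have devD : {morph dev : x y / x + y} by move=> x y; rewrite /dev !rmorphD /=; ring.
have devMn w n : dev (w *+ n) = dev w *+ n.
  by elim: n => [|n IH]; rewrite ?mulr0n // !mulrS devD IH.
have devu : dev u = dev v + \sum_(j < 3) dev t`_j *+ k j.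
  rewrite /u devD (big_morph dev devD dev0).
  by congr (_ + _); apply: eq_bigr => j _; rewrite devMn.
have hu : normc (dev u) <= q + (\sum_(j < 3) k j)%:R * q.
  rewrite devu; apply: le_trans (le_normcD _ _) (lerD (hq _ vt) _).
  by apply: normc_sum_mulrn => j; apply: hq.
have sru : sr u = sr v + \sum_(j < 3) (k j)%:R * sr t`_j.
  rewrite /u rmorphD (raddf_sum sr) /=; congr (_ + _); apply: eq_bigr => j _.
  by rewrite raddfMn mulr_natl.
have su : normc c * sr v + (\sum_(j < 3) k j)%:R * (3 * q) <= normc c * sr u.
  rewrite sru mulrDr lerD2l mulr_sumr natr_sum mulr_suml.
  by apply: ler_sum => j _; rewrite [leRHS]mulrCA ler_wpM2l // h3.
have cs w : 0 <= sr w -> normc (c * (sr w)%:C%C) = normc c * sr w.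
  by move=> w0; rewrite normcM normc_real.
have sv0 : 0 <= sr v by rewrite ltW ?hp.
have su0 : 0 <= sr u.
  by rewrite sru addr_ge0 // sumr_ge0 // => j _; rewrite mulr_ge0 // ltW ?hp.
have nv : normc (sc v) <= normc c * sr v + q.
  rewrite -cs // -[sc v](addrNK (c * (sr v)%:C%C)) addrC.
  by apply: le_trans (le_normcD _ _) _; rewrite lerD2l hq.
have nu : normc c * sr u <= normc (sc u) + normc (dev u).
  rewrite -cs // -(normcN (dev u)); apply: le_trans (le_normcD _ _).
  by rewrite /dev opprB addrC subrK.
have := ler_wpM2r q0 k1R; lra.
Qed.

End HeightStep.

(** * One step of the algorithm *)

Lemma list_argmin (T : eqType) (r : rel T) (l : seq T) : total r -> transitive r ->
  l != [::] -> exists2 x, x \in l & {in l, forall y, r x y}.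
Proof.
move=> rt rtr; have rr x : r x x by have := rt x x; rewrite orbb.
elim: l => // a [|b l] IH _.
  by exists a; rewrite ?mem_head // => y; rewrite inE => /eqP ->.
have [//|x xl hx] := IH; case/orP: (rt a x) => rax.
  exists a; rewrite ?mem_head // => y; rewrite inE => /predU1P[-> //|/hx]; exact: rtr.
exists x; first by rewrite inE xl orbT.
by move=> y; rewrite inE => /predU1P[-> //|/hx].
Qed.

Section Steps.
Variables (R : realType) (K : fieldExtType rat).
Variables (sr : {rmorphism K -> R}) (sc : {rmorphism K -> R[i]}).
Hypothesis sc_nonreal : exists x, complex.Im (sc x) != 0.
Hypothesis hdim : \dim {:K} = 3%N.
Variable L : {pred K}.
Hypothesis hL : is_order L.
Variable tie : rel move.
Hypotheses (tie_total : total tie) (tie_trans : transitive tie).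
Implicit Types (s t : state K).

Lemma state_neq0 s u : is_state L s -> u \in s -> u != 0.
Proof.
by move=> [hb _] us; apply: free_not0 us; apply: basis_free hb.
Qed.

Lemma state_delta_neq0 s : is_state L s -> delta sr sc s != 0.
Proof.
move=> [hb _]; rewrite delta_coords mulf_neq0 ?pnatr_eq0 // normr_eq0.
exact: coords_mx_det_neq0.
Qed.

Lemma norm_ge1 u : u \in L -> u != 0 -> 0 < sr u -> 1 <= sr u * normc (sc u) ^+ 2.
Proof.
move=> uL u0 su; have [n [hn _]] := order_norm sr sc_nonreal hdim hL uL.
have h := ratr_field_norm sr sc_nonreal hdim u.
have hp : 0 < sr u * normc (sc u) ^+ 2.
  rewrite mulr_gt0 // exprn_gt0 // lt0r normc_ge0 andbT.
  by apply: contraNneq u0 => /eq0_normc /eqP; rewrite fmorph_eq0.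
by move: hp; rewrite -h hn ratr_int ltr0z ler1z gtz0_ge1.
Qed.

Lemma height_le s (B : R) : 0 <= B -> positive_state sr s ->
  (forall u, u \in s -> sr u * normc (sc u) ^+ 2 <= B) -> height R s <= B.
Proof.
move=> B0 /allP hs hB; rewrite /height big_seq_cond; apply: bigmax_le => // u.
rewrite andbT => us; rewrite (ratr_field_norm sr sc_nonreal hdim) ger0_norm ?hB //.
by rewrite mulr_ge0 ?sqr_ge0 // ltW ?hs.
Qed.

Lemma norm_le_height s u : u \in s -> sr u * normc (sc u) ^+ 2 <= height R s.
Proof.
move=> us; rewrite -(ratr_field_norm sr sc_nonreal hdim).
apply: le_trans (ler_norm _) _.
exact: (@Order.TotalTheory.le_bigmax_seq _ _ _ _ _ _ xpredT
          (fun u => `|ratr (field_norm u)|)).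
Qed.

Lemma height_ge0 s : 0 <= height R s.
Proof. by rewrite /height bigmax_idl le_max lexx. Qed.

Lemma perm_height s t : perm_eq s t -> height R s = height R t.
Proof. by move=> st; rewrite /height (perm_big _ st). Qed.

(** Let c be the slope of the new state t and q its largest
    deviation.  If the norm of an entry v of t exceeds C_H, then |c| sr w >= 3 q
    for all entries w of t, so the old entry that v was obtained from has both
    a larger real coordinate and a larger complex absolute value. *)
Lemma height_step d s (M : R) : is_state L s -> positive_state sr s ->
  positive_state sr (apply_move d s) -> conf_module sr sc (apply_move d s) <= M ->
  height R (apply_move d s) <= Num.max (height R s) (CH M (delta sr sc s)).
Proof.
move=> hs ps; set t := apply_move d s => pt hM.
have ht : is_state L t by apply: apply_move_state => //; case: hL.
have X0 := real_norm2_gt0 pt.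
pose c := best_slope sr sc t.
have dt : delta sr sc t = delta sr sc s by apply: apply_move_delta.
have hb u v : u \in t -> v \in t ->
    normc (sc u - c * (sr u)%:C%C) ^+ 2 * sr v <= M * delta sr sc s.
  by rewrite -dt; apply: deviation_bound => //; apply: state_delta_neq0.
pose q := \big[Num.max/0]_(u <- t) normc (sc u - c * (sr u)%:C%C).
have q0 : 0 <= q by rewrite /q bigmax_idl le_max lexx.
have hq u : u \in t -> normc (sc u - c * (sr u)%:C%C) <= q.
  move=> ut; exact: (@Order.TotalTheory.le_bigmax_seq _ _ _ _ _ _ xpredT
                       (fun u => normc (sc u - c * (sr u)%:C%C))).
have tp u : u \in t -> 0 < sr u by move/allP: pt; apply.
have D0 : 0 <= M * delta sr sc s.
  have t0 : t`_0 \in t by rewrite mem_nth ?size_tuple.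
  by apply: le_trans (hb _ _ t0 t0); rewrite mulr_ge0 ?sqr_ge0 // ltW ?tp.
have q2 v : v \in t -> q ^+ 2 * sr v <= M * delta sr sc s.
  move=> vt; rewrite -ler_pdivlMr ?tp //.
  rewrite -[leRHS]sqr_sqrtr ?divr_ge0 // ?(ltW (tp _ vt)) //.
  rewrite ler_sqr ?nnegrE ?sqrtr_ge0 // /q big_seq_cond.
  apply: bigmax_le => [|u]; first exact: sqrtr_ge0.
  rewrite andbT => ut; rewrite -ler_sqr ?nnegrE ?normc_ge0 ?sqrtr_ge0 //.
  by rewrite sqr_sqrtr ?divr_ge0 // ?(ltW (tp _ vt)) // ler_pdivlMr ?tp // hb.
have hz w : w \in t -> normc (sc w) <= q + normc c * sr w.
  move=> wt; rewrite -[sc w](subrK (c * (sr w)%:C%C)).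
  apply: le_trans (le_normcD _ _) (lerD (hq _ wt) _).
  by rewrite normcM normc_real // ltW ?tp.
apply: height_le => // [|v vt]; first by rewrite le_max height_ge0.
rewrite le_max; have [hC|hC] := leP (sr v * normc (sc v) ^+ 2) (CH M (delta sr sc s)).
  by rewrite orbT.
have big := slope_large q0 (normc_ge0 c) (tp _ vt) (normc_ge0 _) (q2 _ vt)
                        (hz _ vt) hC.
have h3 w : w \in t -> 3 * q <= normc c * sr w.
  move=> wt; apply: slope_dominates q0 (normc_ge0 c) (tp _ wt) (normc_ge0 _) (hz _ wt) _ big.
  by apply: norm_ge1; rewrite ?tp ?(state_neq0 ht) //; case: ht => _; apply.
have /(nthP 0)[i hi vi] := vt; rewrite size_tuple in hi.
have [k E] := move_nonneg_inverse d s (Ordinal hi).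
rewrite orbC; apply/orP; right.
have us : s`_i \in s by rewrite mem_nth ?size_tuple.
apply: le_trans (norm_le_height us); apply: ler_pM.
- by rewrite ltW ?tp.
- exact: sqr_ge0.
- by rewrite -vi; apply: (apply_move_le (Ordinal hi)).
rewrite ler_sqr ?nnegrE ?normc_ge0 // [s`_i]E -/t /= vi.
exact: (sum_growth k q0 hq tp h3 vt).
Qed.

(** The slope of s is a competitor for the best slope of the new state, and
    |r1 - r3|^2 + |r2|^2 + |r3|^2 <= 4 (|r1|^2 + |r2|^2 + |r3|^2); the
    real coordinates decrease and delta is unchanged. *)
Lemma module_growth s : is_state L s -> positive_state sr s ->
  positive_state sr (apply_move (V 1 0 0) s) ->
  conf_module sr sc (apply_move (V 1 0 0) s) <= 4 * conf_module sr sc s.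
Proof.
move=> hs ps; set t := apply_move _ s => pt.
have Xs := real_norm2_gt0 ps; have Xt := real_norm2_gt0 pt.
have ds : 0 < delta sr sc s by rewrite lt0r state_delta_neq0 //= delta_coords mulr_ge0.
rewrite !conf_moduleE // (apply_move_delta sr sc (V 1 0 0) s) 2!mulrA.
rewrite ler_pM2r ?invr_gt0 //; apply: ler_pM.
- by apply: sumr_ge0 => u _; apply: sqr_ge0.
- exact: sqrtr_ge0.
- apply: le_trans (deviation_min _ (best_slope sr sc s) Xt) _.
  move: (best_slope sr sc s) => c; rewrite !deviationE !sum_state /= !mulr0n !mulr1n !subr0.
  rewrite rmorphB [sr (_ - _)]rmorphB.
  have ReB (x y : R[i]) : complex.Re (x - y) = complex.Re x - complex.Re y.
    by case: x y => ? ? [].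
  have ImB (x y : R[i]) : complex.Im (x - y) = complex.Im x - complex.Im y.
    by case: x y => ? ? [].
  rewrite ReB ImB; move: (complex.Re c) (complex.Im c) => p q.
  have := sqr_ge0 ((complex.Re (sc s`_0) - p * sr s`_0) +
                   (complex.Re (sc s`_2) - p * sr s`_2)).
  have := sqr_ge0 ((complex.Im (sc s`_0) - q * sr s`_0) +
                   (complex.Im (sc s`_2) - q * sr s`_2)).
  have := sqr_ge0 (complex.Re (sc s`_0) - p * sr s`_0).
  have := sqr_ge0 (complex.Im (sc s`_0) - q * sr s`_0).
  have := sqr_ge0 (complex.Re (sc s`_1) - p * sr s`_1).
  have := sqr_ge0 (complex.Im (sc s`_1) - q * sr s`_1).
  have := sqr_ge0 (complex.Re (sc s`_2) - p * sr s`_2).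
  have := sqr_ge0 (complex.Im (sc s`_2) - q * sr s`_2).
  lra.
rewrite ler_sqrt ?(ltW Xs) // /real_norm2 !sum_state.
have le i (hi : (i < 3)%N) : sr t`_i ^+ 2 <= sr s`_i ^+ 2.
  have := apply_move_le (Ordinal hi) pt.
  rewrite -ler_sqr ?nnegrE //= ltW //.
    by move/allP: pt; apply; rewrite mem_nth ?size_tuple.
  by move/allP: ps; apply; rewrite mem_nth ?size_tuple.
by rewrite !lerD ?le.
Qed.

Lemma candidate_V100 s : admissible sr L s -> candidate sr s (V 1 0 0).
Proof.
move=> [[hb _] /allP ps so]; rewrite /candidate /=.
have p i : (i < 3)%N -> 0 < sr s`_i by move=> hi; apply: ps; rewrite mem_nth ?size_tuple.
rewrite /positive_state /= !mulr0n !mulr1n !subr0 !p // !andbT.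
have le : sr s`_2 <= sr s`_0.
  case: s so {hb ps p} => [[|u1 [|u2 [|u3 []]]] //= _] /and3P[h1 h2 _].
  exact: le_trans h2 h1.
rewrite rmorphB subr_gt0 lt_neqAle le andbT.
rewrite fmorph_eq; apply: contraTneq (free_uniq (basis_free hb)) => e.
apply/negP => /(nth_uniq 0 (i:=2) (j:=0)).
by rewrite !size_tuple e eqxx => /(_ isT isT).
Qed.

(** A and B are bounded by archimedeanity, since A x3 < x1 and B x3 < x2; then
    g (x2 - B x3) < x1 bounds g for each of the finitely many B. *)
Lemma candidate_bounded s : admissible sr L s ->
  exists N : nat, forall A B g, candidate sr s (V A B g) ->
    (A <= N)%N /\ (B <= N)%N /\ (g <= N)%N.
Proof.
move=> [_ /allP ps _].
have p i : (i < 3)%N -> 0 < sr s`_i by move=> hi; apply: ps; rewrite mem_nth ?size_tuple.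
have arch (x y : R) : 0 < y -> exists N : nat, forall n : nat, y *+ n < x -> (n <= N)%N.
  move=> y0; have [N hN] : exists N : nat, x < y *+ N.
    exists (Num.truncn (`|x| / y)).+1; rewrite -mulr_natl -ltr_pdivrMr //.
    apply: le_lt_trans (truncnS_gt _); rewrite ler_pM2r ?invr_gt0 //; exact: ler_norm.
  exists N => n hn; rewrite leqNgt; apply/negP => /ltnW hlt.
  by have := ler_wpMn2l (ltW y0) hlt; rewrite leNgt (lt_trans hn hN).
have [NA hA] := arch (sr s`_0) (sr s`_2) (p 2%N isT).
have [NB hB] := arch (sr s`_1) (sr s`_2) (p 2%N isT).
have hg (B : nat) : exists N : nat, forall g : nat, 0 < sr (s`_1 - s`_2 *+ B) ->
    sr (s`_1 - s`_2 *+ B) *+ g < sr s`_0 -> (g <= N)%N.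
  have [h|h] := ltP 0 (sr (s`_1 - s`_2 *+ B)); last by exists 0%N.
  by have [N hN] := arch (sr s`_0) _ h; exists N => g _; apply: hN.
have [G hG] := choice hg.
exists (maxn (maxn NA NB) (\max_(B < NB.+1) G B)) => A B g.
rewrite /candidate /positive_state => /andP[_ /= /and4P[h1 h2 h3 _]].
have hBN : (B <= NB)%N by apply: hB; move: h2; rewrite rmorphB raddfMn subr_gt0.
have e u v w : sr (u - v *+ g - w *+ A) = sr u - sr v *+ g - sr w *+ A.
  by rewrite !rmorphB !rmorphMn.
rewrite e in h1.
have g0 := mulrn_wge0 g (ltW h2); have A0 := mulrn_wge0 A (ltW h3).
split; last split.
- by rewrite !leq_max hA //; lra.
- by rewrite !leq_max hBN orbT.
rewrite leq_max; apply/orP; right.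
apply: leq_trans (leq_bigmax (Ordinal (hBN : (B < NB.+1)%N))).
by apply: hG => //; lra.
Qed.

Lemma selected_exists s : admissible sr L s -> exists d, selected sr sc tie s d.
Proof.
move=> hs; have [N hN] := candidate_bounded hs.
pose l := [seq d <- W :: [seq V p.1.1 p.1.2 p.2 | p : 'I_N.+1 * 'I_N.+1 * 'I_N.+1]
          | candidate sr s d].
have lP d : (d \in l) = candidate sr s d.
  rewrite mem_filter; apply: andb_idr => hd; rewrite inE.
  case: d hd => [A B g|//] /hN[hA [hB hg]] /=.
  apply/mapP; exists (inord A, inord B, inord g); first exact: mem_enum.
  by rewrite /= !inordK.
pose m d := conf_module sr sc (apply_move d s).
pose r d d' := (m d < m d') || (m d == m d') && tie d d'.
have rt : total r.
  by move=> d d'; rewrite /r; case: (ltgtP (m d) (m d')) => //= _; apply: tie_total.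
have rtr : transitive r.
  move=> y x z; rewrite /r => /orP[h1|/andP[/eqP h1 t1]] /orP[h2|/andP[/eqP h2 t2]].
  - by rewrite (lt_trans h1 h2).
  - by rewrite -h2 h1.
  - by rewrite h1 h2.
  - by rewrite h1 h2 eqxx (tie_trans t1 t2) orbT.
have l0 : l != [::].
  by have := candidate_V100 hs; rewrite -lP; apply: contraTneq => ->.
have [d dl hd] := list_argmin rt rtr l0.
exists d; split; first by rewrite -lP.
move=> d' hd'; have := hd d'; rewrite lP => /(_ hd') /orP[h|/andP[/eqP h1 h2]].
  by left.
by right.
Qed.

Lemma select_selected s :
  admissible sr L s -> selected sr sc tie s (select sr sc tie s).
Proof. by move=> hs; apply: (xgetPex W (selected_exists hs)). Qed.

Lemma perm_state s t : perm_eq s t -> is_state L s -> is_state L t.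
Proof.
move=> st [hb hs]; split; first by rewrite -(perm_basis _ st).
by move=> u; rewrite -(perm_mem st); apply: hs.
Qed.

Lemma perm_positive s t : perm_eq s t -> positive_state sr s = positive_state sr t.
Proof. exact: perm_all. Qed.

Lemma perm_resort s : perm_eq (resort sr s) s.
Proof. by rewrite /resort /= perm_sort. Qed.

(** The two facts on which the study of a step rests: the selected move keeps
    coordinates positive, and it does at least as well as V(1,0,0), which is
    always a candidate. *)
Variant next_spec s : state K -> Prop := NextSpec d of
  positive_state sr (apply_move d s) &
  conf_module sr sc (apply_move d s) <=
    conf_module sr sc (apply_move (V 1 0 0) s) :
  next_spec s (resort sr (apply_move d s)).

Lemma next_stateP s : admissible sr L s -> next_spec s (next_state sr sc tie s).
Proof.
move=> hs; have [/andP[_ hp] hm] := select_selected hs.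
apply: NextSpec => //.
by case: (hm _ (candidate_V100 hs)) => [/ltW|[-> _]].
Qed.

Lemma next_admissible s :
  admissible sr L s -> admissible sr L (next_state sr sc tie s).
Proof.
move=> hs; case: (next_stateP hs) => d hp _; have [hs1 _ _] := hs.
have pr := perm_resort (apply_move d s); split.
- apply: (perm_state (s := apply_move d s)); first by rewrite perm_sym.
  by apply: apply_move_state => //; case: hL.
- by rewrite (perm_positive pr).
by apply: sort_sorted => u v; apply: le_total.
Qed.

Lemma next_delta s : admissible sr L s ->
  delta sr sc (next_state sr sc tie s) = delta sr sc s.
Proof.
move=> hs; case: (next_stateP hs) => d hp _.
by rewrite (perm_delta sr sc (perm_resort _)) apply_move_delta.
Qed.

Lemma conf_module_resort s : positive_state sr s ->
  conf_module sr sc (resort sr s) = conf_module sr sc s.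
Proof.
move=> hp; apply: perm_conf_module (perm_resort s).
by apply: real_norm2_gt0; rewrite (perm_positive (perm_resort s)).
Qed.

Lemma next_height s M : admissible sr L s ->
  conf_module sr sc (next_state sr sc tie s) <= M ->
  height R (next_state sr sc tie s) <=
    Num.max (height R s) (CH M (delta sr sc s)).
Proof.
move=> hs; have [hs1 hs2 _] := hs; case: (next_stateP hs) => d hp _.
rewrite conf_module_resort // (perm_height (perm_resort _)).
exact: height_step.
Qed.

Lemma next_module s : admissible sr L s ->
  conf_module sr sc (next_state sr sc tie s) <= 4 * conf_module sr sc s.
Proof.
move=> hs; have [hs1 hs2 _] := hs; case: (next_stateP hs) => d hp hm.
rewrite conf_module_resort //; apply: le_trans hm (module_growth _ _ _) => //.
by have /andP[] := candidate_V100 hs.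
Qed.

Lemma orbit_admissible s (t : nat) :
  admissible sr L s -> admissible sr L (algo_orbit sr sc tie s t).
Proof. by move=> hs; elim: t => //= t IH; apply: next_admissible. Qed.

Lemma orbit_delta s (t : nat) : admissible sr L s ->
  delta sr sc (algo_orbit sr sc tie s t) = delta sr sc s.
Proof.
move=> hs; elim: t => //= t IH; rewrite next_delta //.
exact: orbit_admissible.
Qed.

Lemma orbit_height_step s M (t : nat) : admissible sr L s ->
  (forall t : nat, conf_module sr sc (algo_orbit sr sc tie s t) <= M) ->
  height R (algo_orbit sr sc tie s t.+1) <=
  Num.max (height R (algo_orbit sr sc tie s t)) (CH M (delta sr sc s)).
Proof.
move=> hs hM; have ht := orbit_admissible t hs.
by rewrite -(orbit_delta t hs); apply: next_height => //; apply: (hM t.+1).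
Qed.

Lemma orbit_height s M (t : nat) : admissible sr L s ->
  (forall t : nat, conf_module sr sc (algo_orbit sr sc tie s t) <= M) ->
  height R (algo_orbit sr sc tie s t) <=
    Num.max (height R s) (CH M (delta sr sc s)).
Proof.
move=> hs hM; elim: t => [|t IH]; first by rewrite le_max lexx.
apply: le_trans (orbit_height_step t hs hM) _.
by rewrite ge_max IH le_max lexx orbT.
Qed.

Lemma hyp_B_bounded s (B : R) :
  (forall t : nat, height R (algo_orbit sr sc tie s t) <= B) -> hyp_B sr sc tie s.
Proof.
move=> hB; rewrite /hyp_B limn_einf_lim.
apply: (@le_lt_trans _ _ B%:E); last exact: ltry.
apply: lime_le; first exact: is_cvg_einfs.
apply: nearW => n; apply: (@le_trans _ _ (height R (algo_orbit sr sc tie s n))%:E).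
  by apply: ereal_inf_lbound; exists n => /=.
by rewrite lee_fin.
Qed.

End Steps.

(** * Bounded modules and periodicity *)

(** Every n is at most kappa steps after some r with u r <= 4 max(u 0, m0).  From
    such an r the next one is r + 1 if u r <= m0, and otherwise the return
    time r + k, where k > 0 because u has decreased. *)
Lemma bounded_of_returns (R : realType) (u : nat -> R) (gamma m0 : R)
    (kappa : nat) :
  1 < gamma -> 0 < m0 ->
  (forall n, u n.+1 <= 4 * u n) ->
  (forall n, m0 <= u n -> exists2 k : nat, (k <= kappa)%N &
     u (k + n)%N <= Num.max (u n / gamma) m0) ->
  exists M, forall n, u n <= M.
Proof.
move=> g1 m00 ugrow uret; pose m1 := Num.max (u 0%N) m0.
have m1p : 0 < m1 by rewrite lt_max m00 orbT.
have m0m1 : m0 <= m1 by rewrite le_max lexx orbT.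
have ret n : exists r : nat, [/\ (r <= n)%N, (n <= r + kappa)%N & u r <= 4 * m1].
  elim: n => [|n [r [rn nr ur]]].
    by exists 0%N; split=> //; rewrite (@le_trans _ _ m1) // ?le_max ?lexx //; lra.
  have [h|h] := leqP n.+1 (r + kappa)%N; first by exists r; split=> //; apply: leqW.
  have [u0|u0] := leP (u r) m0.
    exists r.+1; split; [lia|lia|].
    by apply: le_trans (ugrow r) _; rewrite ler_pM2l // (le_trans u0).
  have [k kk uk] := uret r (ltW u0).
  have ug : u r / gamma < u r.
    by rewrite ltr_pdivrMr ?ltr_pMr //; lra.
  have k0 : (0 < k)%N.
    rewrite lt0n; apply: contraTneq uk => ->.
    by rewrite add0n -ltNge gt_max ug u0.
  exists (k + r)%N; split; [lia|lia|].
  apply: le_trans uk _; rewrite ge_max; apply/andP; split; last by lra.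
  by apply: le_trans (ltW ug) ur.
exists (4 ^+ kappa * (4 * m1)) => n; have [r [rn nr ur]] := ret n.
have grow j : u (j + r)%N <= 4 ^+ j * (4 * m1).
  elim: j => [|j IH]; first by rewrite expr0 mul1r.
  by rewrite addSn exprS -mulrA; apply: le_trans (ugrow _) _; rewrite ler_pM2l.
rewrite -(subnK rn); apply: le_trans (grow _) _.
apply: ler_wpM2r; first by rewrite mulr_ge0 // ltW.
by rewrite ler_eXn2l ?ltr1n //; lia.
Qed.

Lemma nat_pigeonhole (T : finType) (f : nat -> T) :
  exists i j, (i < j)%N /\ f i = f j.
Proof.
apply: contrapT => h.
have inj : injective (fun i : 'I_(#|T|).+1 => f i).
  move=> i j fij; apply/val_inj; case: (ltngtP i j) => // lt; case: h.
    by exists i, j.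
  by exists j, i.
by have := leq_card _ inj; rewrite card_ord ltnn.
Qed.

Section Periodicity.
Variables (R : realType) (K : fieldExtType rat).
Variables (sr : {rmorphism K -> R}) (sc : {rmorphism K -> R[i]}).
Hypothesis sc_nonreal : exists x, complex.Im (sc x) != 0.
Hypothesis hdim : \dim {:K} = 3%N.
Variable L : {pred K}.
Hypothesis hL : is_order L.
Variable tie : rel move.
Hypotheses (tie_total : total tie) (tie_trans : transitive tie).
Implicit Types (s : state K).

Lemma orbit_module_bounded kappa s : hyp_C sr sc tie L kappa -> admissible sr L s ->
  exists M, forall t, conf_module sr sc (algo_orbit sr sc tie s t) <= M.
Proof.
move=> [gamma [m0 [g1 m01 ret]]] hs.
have had t := orbit_admissible sc hdim hL tie_total tie_trans t hs.
apply: (bounded_of_returns (kappa := kappa) g1 (lt_le_trans ltr01 m01)) => n.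
  exact: (next_module sc_nonreal tie_total tie_trans (had n)).
move=> hn; have [k kk hk] := ret _ (had n) hn.
by exists k => //; rewrite /algo_orbit iterD.
Qed.

Lemma scale_positive l s :
  0 < sr l -> positive_state sr (scale_state l s) = positive_state sr s.
Proof.
move=> l0; rewrite /positive_state all_map; apply: eq_all => u /=.
by rewrite rmorphM pmulr_rgt0.
Qed.

Lemma scale_resort l s :
  0 < sr l -> resort sr (scale_state l s) = scale_state l (resort sr s).
Proof.
move=> l0; apply: val_inj; rewrite /=; symmetry; apply: map_sort => u v /=.
by rewrite !rmorphM ler_pM2l.
Qed.

(** Both the candidates and their modules are invariant under scaling. *)
Lemma scale_select l s :
  0 < sr l -> select sr sc tie (scale_state l s) = select sr sc tie s.
Proof.
move=> l0; congr (xget W _).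
have cE d : candidate sr (scale_state l s) d = candidate sr s d.
  by rewrite /candidate scale_apply_move scale_positive.
have mE d : candidate sr s d -> conf_module sr sc (apply_move d (scale_state l s)) =
    conf_module sr sc (apply_move d s).
  by move=> /andP[_ hp]; rewrite scale_apply_move scale_conf_module ?real_norm2_gt0.
apply/seteqP; split=> d [hd hm].
  rewrite cE in hd; split=> // d' hd'; have := hm d'; rewrite cE => /(_ hd').
  by rewrite !mE.
split; first by rewrite cE.
by move=> d'; rewrite cE => hd'; have := hm d' hd'; rewrite !mE.
Qed.

Lemma scale_orbit l s t : 0 < sr l ->
  algo_orbit sr sc tie (scale_state l s) t = scale_state l (algo_orbit sr sc tie s t).
Proof.
move=> l0; elim: t => //= t ->.
by rewrite /next_state scale_select // scale_apply_move scale_resort.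
Qed.

Lemma orbitD s (m n : nat) : algo_orbit sr sc tie s (m + n) =
  algo_orbit sr sc tie (algo_orbit sr sc tie s n) m.
Proof. exact: iterD. Qed.

Lemma periodic_of_repeat s i j l : (i < j)%N -> is_int_unit l -> 0 < sr l ->
  algo_orbit sr sc tie s j = scale_state l (algo_orbit sr sc tie s i) ->
  eventually_periodic sr sc tie s.
Proof.
move=> ij ul l0 e.
have per t : (i <= t)%N ->
    algo_orbit sr sc tie s (t + (j - i)) = scale_state l (algo_orbit sr sc tie s t).
  move=> it; rewrite (_ : t + (j - i) = (t - i) + j)%N; last by lia.
  by rewrite orbitD e scale_orbit // -orbitD subnK.
exists i, (j - i)%N, l; split=> //; first by rewrite subn_gt0.
by exists i => t it; rewrite /digit per // scale_select.
Qed.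

(** Since x_0 |z_0|^2 >= 1, the bound q^2 <= D / x_0 on deviations becomes
    q <= sqrt D |z_0|, in units of the first entry.  Hence
    |c| x_0 <= (1 + sqrt D) |z_0|, and |z_u| <= q + |c| x_u with x_u <= x_0. *)
Lemma ratio_bounded s (M : R) u :
  admissible sr L s -> conf_module sr sc s <= M -> u \in s ->
  sr u <= sr s`_0 /\
  normc (sc u) <= (1 + 2 * Num.sqrt (M * delta sr sc s)) * normc (sc s`_0).
Proof.
move=> [hs hp so] hM us.
have s0 : s`_0 \in s by rewrite mem_nth ?size_tuple.
have le : sr u <= sr s`_0.
  have [h1 h2] : sr s`_1 <= sr s`_0 /\ sr s`_2 <= sr s`_1.
    by case: s so {hs hp hM s0 us} => [[|u1 [|u2 [|u3 []]]] //= _] /and3P[].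
  have /(nthP 0)[i hi <-] := us; rewrite size_tuple in hi.
  by case: i hi => [|[|[|]]] // _; apply: le_trans h2 h1.
split=> //; have X0 := real_norm2_gt0 hp.
have p v : v \in s -> 0 < sr v by move/allP: hp; apply.
set D := M * _; pose c := best_slope sr sc s.
have dq v : v \in s -> normc (sc v - c * (sr v)%:C%C) <= Num.sqrt D * normc (sc s`_0).
  move=> vs; have hD := deviation_bound X0 (state_delta_neq0 sr sc_nonreal hs) hM vs s0.
  have D0 : 0 <= D by apply: le_trans hD; rewrite mulr_ge0 ?sqr_ge0 // ltW ?p.
  rewrite -ler_sqr ?nnegrE ?mulr_ge0 ?sqrtr_ge0 ?normc_ge0 // exprMn sqr_sqrtr //.
  rewrite -(ler_pM2r (p _ s0)); apply: le_trans hD _.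
  rewrite -mulrA -[leLHS]mulr1 ler_wpM2l // [leRHS]mulrC.
  apply: (norm_ge1 sc_nonreal hdim hL); rewrite ?p //; first by case: hs => _; apply.
  exact: (state_neq0 hs).
have cs w : w \in s -> normc (c * (sr w)%:C%C) = normc c * sr w.
  by move=> ws; rewrite normcM normc_real // ltW ?p.
have h1 : normc c * sr s`_0 <= normc (sc s`_0) + Num.sqrt D * normc (sc s`_0).
  rewrite -cs // -[c * _](subrK (sc s`_0)) addrC.
  apply: le_trans (le_normcD _ _) _; rewrite lerD2l -normcN opprB; exact: dq.
have h2 : normc (sc u) <= Num.sqrt D * normc (sc s`_0) + normc c * sr u.
  rewrite -cs // -[sc u](subrK (c * (sr u)%:C%C)).
  by apply: le_trans (le_normcD _ _) (lerD (dq _ us) _).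
have := ler_wpM2l (normc_ge0 c) le; lra.
Qed.

(** On integers of absolute value at most n this is injective; the shift by n
    makes them natural numbers. *)
Definition enc (n : nat) (x : int) : 'I_(2 * n).+1 := inord (absz (x + n%:Z)).

Lemma enc_inj n (x y : int) :
  `|x| <= n%:Z -> `|y| <= n%:Z -> enc n x = enc n y -> x = y.
Proof.
move=> hx hy /(congr1 val) /=; rewrite !inordK; [|lia|lia].
by lia.
Qed.

(** A description of s up to units by integers: a gives the first entry modulo
    N L, and p1, p2 give the ratios of the other entries to it, with N as a
    common denominator. *)
Definition projective_data (e : 3.-tuple K) s (N : int) (a p1 p2 : 'rV[int]_3) :=
  [/\ 0 < N, forall x, x \in L -> N%:~R * x / s`_0 \in L,
      exists2 b, b \in L & s`_0 = int_comb e a + N%:~R * b,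
      N%:~R * s`_1 / s`_0 = int_comb e p1
    & N%:~R * s`_2 / s`_0 = int_comb e p2].

(** N is the norm of the first entry, which is at most the height; the ratios
    are bounded by [ratio_bounded]. *)
Lemma bounded_projective_data s (B M : R) (C : nat) (e : 3.-tuple K) :
  let B' := B * (1 + 2 * Num.sqrt (M * delta sr sc s)) in
  (forall x, x \in L <-> exists a, x = int_comb e a) ->
  (forall a : 'rV[int]_3, (forall j, `|coords sr sc (int_comb e a) 0 j| <= B') ->
    forall i, `|a 0 i|%:~R <= C%:R :> R) ->
  B <= C%:R ->
  admissible sr L s -> conf_module sr sc s <= M -> height R s <= B ->
  exists (N : int) (a p1 p2 : 'rV[int]_3),
    [/\ projective_data e s N a p1 p2, `|N| <= C%:Z
      & forall j, [/\ `|a 0 j| <= C%:Z, `|p1 0 j| <= C%:Z & `|p2 0 j| <= C%:Z]].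
Proof.
move=> B' he hC BC hs hM hB; have [[hb sL] /allP hp _] := hs.
have m i : (i < 3)%N -> s`_i \in s by move=> hi; rewrite mem_nth ?size_tuple.
have [N [hN hdiv]] := order_norm sr sc_nonreal hdim hL (sL _ (m 0%N isT)).
have s00 : s`_0 != 0 by apply: (state_neq0 (L := L)) (m 0%N isT); case: hs.
have {}hdiv := hdiv s00.
have hNR : N%:~R = sr s`_0 * normc (sc s`_0) ^+ 2.
  by rewrite -(ratr_field_norm sr sc_nonreal hdim) hN ratr_int.
have x0 := hp _ (m 0%N isT).
have n0 : 0 < normc (sc s`_0).
  rewrite lt0r normc_ge0 andbT.
  by apply: contraNneq s00 => /eq0_normc /eqP; rewrite fmorph_eq0.
have Npos : 0 < N by rewrite -(ltr0z R) hNR mulr_gt0 // exprn_gt0.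
have NB : N%:~R <= B.
  by rewrite hNR; apply: le_trans hB; apply: norm_le_height => //; apply: m.
have NC : `|N| <= C%:Z.
  by rewrite gtr0_norm // -(ler_int R); apply: le_trans NB BC.
have ratio i : (i < 3)%N -> exists2 p, N%:~R * s`_i / s`_0 = int_comb e p &
    forall j, `|p 0 j| <= C%:Z.
  move=> hi; have [p hpE] := proj1 (he _) (hdiv _ (sL _ (m i hi))).
  exists p => // j; rewrite -(ler_int R); apply: hC => k; rewrite -hpE.
  have [h1 h2] := ratio_bounded hs hM (m i hi).
  set D := 1 + _ in h2 *.
  have D1 : 1 <= D by rewrite lerDl mulr_ge0 ?sqrtr_ge0.
  have B0 : 0 <= B by apply: le_trans NB; rewrite ler0z ltW.
  have hr : `|sr (N%:~R * s`_i / s`_0)| <= B * D.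
    rewrite !fmorph_div !rmorphM rmorph_int /= ger0_norm; last first.
      by rewrite divr_ge0 ?mulr_ge0 ?ler0z ?ltW // hp // m.
    rewrite -mulrA; apply: ler_pM => //; first by rewrite ler0z ltW.
      by rewrite divr_ge0 ?ltW // hp // m.
    by apply: le_trans D1; rewrite ler_pdivrMr // mul1r.
  have hc : normc (sc (N%:~R * s`_i / s`_0)) <= B * D.
    rewrite fmorph_div rmorphM rmorph_int /= normcM normcM normcV.
    have -> : normc (N%:~R : R[i]) = N%:~R.
      by rewrite -(rmorph_int (real_complex R)) normc_real // ler0z ltW.
    rewrite -mulrA; apply: ler_pM => //; first by rewrite ler0z ltW.
      by rewrite divr_ge0 ?normc_ge0.
    by rewrite ler_pdivrMr.
  have sq (a b : R) : `|a| <= Num.sqrt (a ^+ 2 + b ^+ 2).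
    by rewrite -sqrtr_sqr ler_sqrt ?addr_ge0 ?sqr_ge0 // lerDl sqr_ge0.
  rewrite mxE; move: hc; case: (sc _) => a b /= hc.
  case: k => [[|[|[|]]]] // _ /=; apply: le_trans hc; first exact: sq.
  by rewrite addrC; apply: sq.
have [p1 h1 b1] := ratio 1%N isT; have [p2 h2 b2] := ratio 2%N isT.
have [a ha] := proj1 (he _) (sL _ (m 0%N isT)).
pose r : 'rV[int]_3 := \row_j modz (a 0 j) N.
pose q : 'rV[int]_3 := \row_j divz (a 0 j) N.
have aE : a = r + N *: q.
  by apply/rowP => j; rewrite !mxE addrC mulrC -divz_eq.
exists N, r, p1, p2; split=> [|//|j]; last first.
  split=> //; rewrite mxE ger0_norm ?modz_ge0 ?lt0r_neq0 //.
  by apply: le_trans NC; rewrite gtr0_norm // ltW // ltz_pmod.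
split=> //; exists (int_comb e q); first by apply: (proj2 (he _)); exists q.
by rewrite ha aE int_combD int_combZ mulrzl.
Qed.

(** Equal residues modulo N give s'_0 - s_0 in N L, so that the quotient
    l = s'_0 / s_0 = 1 + (s'_0 - s_0) / s_0 and its inverse lie in L; equal ratios
    extend s'_0 = l s_0 to the other entries. *)
Lemma unit_multiple_of_data s s' (e : 3.-tuple K) (N : int) (a p1 p2 : 'rV[int]_3) :
  positive_state sr s -> positive_state sr s' ->
  projective_data e s N a p1 p2 -> projective_data e s' N a p1 p2 ->
  exists2 l, is_int_unit l /\ 0 < sr l & s' = scale_state l s.
Proof.
move=> /allP hp /allP hp' [N0 hd [b bL e0] e1 e2] [_ hd' [b' bL' e0'] e1' e2'].
have [[L1 LB _] Lint _] := hL.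
have x0 : 0 < sr s`_0 by apply: hp; rewrite mem_nth ?size_tuple.
have x0' : 0 < sr s'`_0 by apply: hp'; rewrite mem_nth ?size_tuple.
have z0 : s`_0 != 0 by apply: contraTneq x0 => ->; rewrite rmorph0 ltxx.
have z0' : s'`_0 != 0 by apply: contraTneq x0' => ->; rewrite rmorph0 ltxx.
have NK : N%:~R != 0 :> K.
  by rewrite -(fmorph_eq0 sr) rmorph_int intr_eq0 lt0r_neq0.
pose l := s'`_0 / s`_0.
have lL : l \in L.
  have -> : l = 1 - N%:~R * (b - b') / s`_0.
    apply: (mulIf z0); rewrite mulrBl !divfK // mul1r {1}e0 e0'; ring.
  by rewrite LB // hd // LB.
have lL' : l^-1 \in L.
  have -> : l^-1 = 1 - N%:~R * (b' - b) / s'`_0.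
    rewrite /l invf_div; apply: (mulIf z0'); rewrite mulrBl !divfK // mul1r {1}e0' e0; ring.
  by rewrite LB // hd' // LB.
exists l.
  split; last by rewrite fmorph_div divr_gt0.
  by split; [rewrite mulf_neq0 ?invr_eq0 | apply: Lint | apply: Lint].
have main i p : N%:~R * s`_i / s`_0 = int_comb e p ->
    N%:~R * s'`_i / s'`_0 = int_comb e p -> s'`_i = l * s`_i.
  move=> h h'; apply: (mulfI NK); apply: (mulIf (invr_neq0 z0')); rewrite h' -h /l.
  by field; rewrite z0 z0'.
apply: eq_from_tnth => i; rewrite tnth_map !(tnth_nth 0).
case: i => [[|[|[|]]]] //= _; [by rewrite /l divfK | exact: main e1 e1' | exact: main e2 e2'].
Qed.

(** The states of the orbit have finitely many possible projective data, so two
    of them share their data and differ by a unit. *)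
Lemma orbit_eventually_periodic s (B M : R) : admissible sr L s ->
  (forall t, height R (algo_orbit sr sc tie s t) <= B) ->
  (forall t, conf_module sr sc (algo_orbit sr sc tie s t) <= M) ->
  eventually_periodic sr sc tie s.
Proof.
move=> hs hB hM; have [e [eb he]] := order_basis hdim hL.
have had t := orbit_admissible sc hdim hL tie_total tie_trans t hs.
have [c hc] := int_comb_bounded sr sc_nonreal eb.
pose B1 := B * (1 + 2 * Num.sqrt (M * delta sr sc s)).
have [C [hC1 hC2]] : exists C : nat, B <= C%:R /\ c * B1 <= C%:R.
  exists (Num.truncn (Num.max B (c * B1))).+1.
  have := truncnS_gt (Num.max B (c * B1)); rewrite gt_max => /andP[h1 h2].
  by rewrite !ltW.
have had_data t : exists d : int * 'rV[int]_3 * 'rV[int]_3 * 'rV[int]_3,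
    let: (N, a, p1, p2) := d in
    [/\ projective_data e (algo_orbit sr sc tie s t) N a p1 p2, `|N| <= C%:Z
      & forall j, [/\ `|a 0 j| <= C%:Z, `|p1 0 j| <= C%:Z & `|p2 0 j| <= C%:Z]].
  have [|N [a [p1 [p2 h]]]] := bounded_projective_data he _ hC1 (had t) (hM t) (hB t).
    rewrite (orbit_delta sc hdim hL tie_total tie_trans t hs) => a ha i.
    by apply: le_trans hC2; apply: hc.
  by exists (N, a, p1, p2).
have [d hd] := choice had_data.
pose f t := let: (N, a, p1, p2) := d t in
  (enc C N, map_mx (enc C) a, map_mx (enc C) p1, map_mx (enc C) p2).
have [i [j [ij]]] := nat_pigeonhole f.
have := hd i; have := hd j; rewrite /f.
case: (d i) (d j) => [[[N a] p1] p2] [[[N' a'] p1'] p2'].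
move=> [dj NC' bd'] [di NC bd] [eN ea ep1 ep2].
have EN := enc_inj NC NC' eN.
have row (x y : 'rV[int]_3) :
    (forall k, `|x 0 k| <= C%:Z) -> (forall k, `|y 0 k| <= C%:Z) ->
    map_mx (enc C) x = map_mx (enc C) y -> x = y.
  move=> hx hy exy; apply/rowP => k; apply: (enc_inj (hx k) (hy k)).
  by have /rowP/(_ k) := exy; rewrite !mxE.
have Ea : a = a' by apply: row ea => k; [case: (bd k) | case: (bd' k)].
have Ep1 : p1 = p1' by apply: row ep1 => k; [case: (bd k) | case: (bd' k)].
have Ep2 : p2 = p2' by apply: row ep2 => k; [case: (bd k) | case: (bd' k)].
rewrite -EN -Ea -Ep1 -Ep2 in dj.
have [_ pi _] := had i; have [_ pj _] := had j.
have [l [ul l0] hl] := unit_multiple_of_data pi pj di dj.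
exact: periodic_of_repeat ij ul l0 hl.
Qed.

End Periodicity.

Theorem theorem4p14 (R : realType) (K : fieldExtType rat)
    (sigma_r : {rmorphism K -> R}) (sigma_c : {rmorphism K -> R[i]})
    (hdim : \dim {:K} = 3%N) (hsig : signature11 sigma_r sigma_c)
    (L : {pred K}) (hL : is_order L)
    (tie : rel move)
    (tie_total : total tie) (tie_trans : transitive tie)
    (tie_anti : antisymmetric tie) :
  let s_ (s0 : state K) (t : nat) := algo_orbit sigma_r sigma_c tie s0 t in
  let m := conf_module sigma_r sigma_c in
  let H := @height R K in
  (forall (s0 : state K) (mstar : R),
     admissible sigma_r L s0 ->
     (forall t, m (s_ s0 t) <= mstar) ->
     let dlt := delta sigma_r sigma_c s0 in
     [/\ forall t, delta sigma_r sigma_c (s_ s0 t) = dlt,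
         forall t, H (s_ s0 t.+1) <= Num.max (H (s_ s0 t)) (CH mstar dlt),
         forall t, H (s_ s0 t) <= Num.max (H s0) (CH mstar dlt)
       & hyp_B sigma_r sigma_c tie s0])
  /\
  (forall kappa : nat, hyp_C sigma_r sigma_c tie L kappa ->
     forall s0 : state K, admissible sigma_r L s0 ->
       hyp_B sigma_r sigma_c tie s0 /\
       eventually_periodic sigma_r sigma_c tie s0).
Proof.
have [sc_nonreal _] := hsig.
split=> [s0 mstar hs hm dlt|kappa hC s0 hs].
  have step t := orbit_height_step sc_nonreal hdim hL tie_total tie_trans t hs hm.
  have bound t := orbit_height sc_nonreal hdim hL tie_total tie_trans t hs hm.
  split=> // [t|]; first exact: (orbit_delta sigma_c hdim hL tie_total tie_trans t hs).
  exact: hyp_B_bounded bound.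
have [M hM] := orbit_module_bounded sc_nonreal hdim hL tie_total tie_trans hC hs.
have bound t := orbit_height sc_nonreal hdim hL tie_total tie_trans t hs hM.
split; first exact: hyp_B_bounded bound.
exact: (orbit_eventually_periodic sc_nonreal hdim hL tie_total tie_trans hs bound hM).
Qed.
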